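(* Let $\boldsymbol t=(t_1,\dots,t_l)$ be a solution of the Bethe ansatz equation associated to $\boldsymbol\lambda,\boldsymbol b,l,Q$ with $t_i\ne t_j$ for $i\ne j$, and let $y(x)=\prod_{i=1}^l(x-t_i)$. Then $\mathcal D^Q(x,\tau)\widehat{\mathbb B}_l(\boldsymbol t)=\mathcal D^Q_{\boldsymbol t,\boldsymbol\lambda,\boldsymbol b}(x,\tau)\widehat{\mathbb B}_l(\boldsymbol t)$, where $\mathcal D^Q_{\boldsymbol t,\boldsymbol\lambda,\boldsymbol b}(x,\tau)=\Big(1-q_1\zeta_1(x)\frac{y(x-1)}{y(x)}\tau\Big)\Big(1-q_2\zeta_2(x)\frac{y(x-1)}{y(x)}\tau\Big)^{-1}$ with $\zeta_1(x)=\prod_{s=1}^k\frac{x-b_s+\lambda^{(s)}_1}{x-b_s}$, $\zeta_2(x)=\prod_{s=1}^k\frac{x-b_s-\lambda^{(s)}_2}{x-b_s}$; i.e. for each $m\ge0$ the coefficients of $\tau^m$ of both sides agree.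
   Context: Yangian and modules: $\mathbb{C}^{1|1}$ with basis $v_1$ (even), $v_2$ (odd), $|1|=\bar0,|2|=\bar1$; $\mathfrak{gl}_{1|1}$ with basis $e_{ij}$, $[e_{ij},e_{rs}]=\delta_{jr}e_{is}-(-1)^{(|i|+|j|)(|r|+|s|)}\delta_{is}e_{rj}$; $P=\sum_{i,j}(-1)^{|j|}E_{ij}\otimes E_{ji}$, $\mathcal R(x)=1+P/x$; $\mathrm{Y}(\mathfrak{gl}_{1|1})$ generated by $T^{(r)}_{ij}$ (parity $|i|+|j|$) with $\mathcal R^{(12)}(x_1-x_2)T^{(13)}(x_1)T^{(23)}(x_2)=T^{(23)}(x_2)T^{(13)}(x_1)\mathcal R^{(12)}(x_1-x_2)$, $T_{ij}(x)=\delta_{ij}+\sum_rT^{(r)}_{ij}x^{-r}$; coproduct $\Delta(T_{ij}(x))=\sum_rT_{rj}(x)\otimes T_{ir}(x)$. Evaluation module $M(z)$: $T_{ij}(x)$ acts by $\delta_{ij}+(-1)^{|j|}e_{ji}(x-z)^{-1}$. For non-degenerate weights $\lambda^{(s)}=(\lambda^{(s)}_1,\lambda^{(s)}_2)\in\mathbb{C}^2$ ($\lambda^{(s)}_1+\lambda^{(s)}_2\ne0$), $L_{\lambda}$ is the irreducible $\mathfrak{gl}_{1|1}$-module generated by an even $v_\lambda$ with $e_{12}v_\lambda=0$, $e_{ii}v_\lambda=\lambda_iv_\lambda$; $L(\boldsymbol\lambda,\boldsymbol b)=\bigotimes_{s=1}^kL_{\lambda^{(s)}}(b_s)$, $\boldsymbol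 b\in\mathbb{C}^k$, vacuum $|0\rangle=\otimes v_{\lambda^{(s)}}$; $\varphi_{\boldsymbol\lambda,\boldsymbol b}(x)=\prod_s(x-b_s+\lambda^{(s)}_1)$, $\psi_{\boldsymbol\lambda,\boldsymbol b}(x)=\prod_s(x-b_s-\lambda^{(s)}_2)$. $Q=\mathrm{diag}(q_1,q_2)$, $q_i\in\mathbb{C}^\times$. $\boldsymbol t$ is a solution of the Bethe ansatz equation if $\prod_i(x-t_i)$ divides $q_1\varphi_{\boldsymbol\lambda,\boldsymbol b}(x)-q_2\psi_{\boldsymbol\lambda,\boldsymbol b}(x)$. $\widehat{\mathbb B}_l(\boldsymbol t)=\prod_{i=1}^l\prod_{s=1}^k(t_i-b_s)\prod_{i<j}(t_j-t_i+1)^{-1}T_{12}(t_1)\cdots T_{12}(t_l)|0\rangle$, where $T_{12}(t)$ is the rational operator $T_{12}(x)$ on $L(\boldsymbol\lambda,\boldsymbol b)$ evaluated at $x=t$ (extended by continuity where needed). $\tau$ is the shift operator, $\tau g(x)=g(x-1)\tau$ for functions/series $g$ of $x$. $\mathcal D^Q(x,\tau)$ is the formal power series in $\tau$ (coefficients written to the left of $\tau^m$, in $\mathrm{Y}(\mathfrak{gl}_{1|1})[[x^{-1}]]$) given by $\mathcal D^Q(x,\tau)=\big(1-q_1T_{11}(x)\tau+q_1T_{12}(x)\tau(1-q_2T_{22}(x)\tau)^{-1}q_2T_{21}(x)\tau\big)(1-q_2T_{22}(x)\tau)^{-1}$, with $(1-q_2T_{22}(x)\tau)^{-1}=\sum_{m\ge0}(q_2T_{22}(x)\tau)^m$;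 it equals the Berezinian $\mathrm{Ber}(1-T^t(x)Q\tau)$. The right-hand side is similarly expanded as a power series in $\tau$ with rational function coefficients. *)

(* Defs.v *)
From HB Require Import structures.
From mathcomp Require Import all_boot all_order all_algebra.
From mathcomp Require Export mpoly.
Set Implicit Arguments.
Unset Strict Implicit.
Unset Printing Implicit Defensive.
Import Order.TTheory GRing.Theory Num.Theory.
Local Open Scope ring_scope.

(* Conventions: the indices 1,2 of gl(1|1) are encoded by bool:
   false <-> 1 (even), true <-> 2 (odd); thus the parity |i| is the bool i. *)

(* A series  sum_m c_m(x) tau^m  (coefficients written to the left of tau^m)
   is represented by its coefficient function  m |-> (x |-> c_m(x)),
   coefficients in a ring R.  Since tau g(x) = g(x-1) tau, the product is
   (sum_p a_p(x) tau^p)(sum_n b_n(x) tau^n) = sum_m (sum_{p+n=m} a_p(x) b_n(x-p)) tau^m. *)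
Section TauSeries.
Variables (F : fieldType) (R : pzRingType).
Definition tser := nat -> F -> R.
Definition ts_one : tser := fun m _ => (m == 0%N)%:R.
Definition ts_tau (a : F -> R) : tser := fun m x => if m == 1%N then a x else 0.
Definition ts_add (A B : tser) : tser := fun m x => A m x + B m x.
Definition ts_sub (A B : tser) : tser := fun m x => A m x - B m x.
Definition ts_mul (A B : tser) : tser :=
  fun m x => \sum_(p < m.+1) A p x * B (m - p)%N (x - p%:R).
(* (1 - a(x) tau)^{-1} := sum_{m>=0} (a(x) tau)^m ,
   (a(x) tau)^m = a(x) a(x-1) ... a(x-m+1) tau^m *)
Definition ts_geom (a : F -> R) : tser := fun m x => \prod_(j < m) a (x - j%:R).
End TauSeries.

(* L_lambda (lambda1 + lambda2 <> 0) has basis v = v_lambda (index false, even)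
   and w = e21 v (index true, odd).  glact l1 l2 a b o c is the (o,c) matrix
   entry of e_ab acting on L_lambda:
     e11 = diag(l1, l1-1), e22 = diag(l2, l2+1), e12 w = (l1+l2) v, e12 v = 0,
     e21 v = w, e21 w = 0. *)
Section Modules.
Variable S : comPzRingType.

Definition glact (l1 l2 : S) (a b : bool) (o c : bool) : S :=
  match a, b with
  | false, false => if o == c then (if c then l1 - 1 else l1) else 0
  | true, true => if o == c then (if c then l2 + 1 else l2) else 0
  | false, true => if (~~ o) && c then l1 + l2 else 0
  | true, false => if o && ~~ c then 1 else 0
  end.

(* Evaluation module L_lambda(z): T_ij(x) acts by
   delta_ij + (-1)^{|j|} e_ji (x - z)^{-1}.  We use the numerator
   (x - z) T_ij(x) = (x - z) delta_ij + (-1)^{|j|} e_ji, which is polynomial in x. *)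
Definition evTnum (l1 l2 z : S) (i j : bool) (x : S) (o c : bool) : S :=
  (x - z) * ((i == j) && (o == c))%:R + (-1) ^+ j * glact l1 l2 j i o c.

(* Basis of the tensor product L(lambda,b) = L_{lambda^(1)}(b_1) (x) ... (x) L_{lambda^(k)}(b_k):
   c : {ffun 'I_k -> bool}, c s = false (resp. true) meaning v (resp. w) in factor s. *)
Definition tbasis (k : nat) := {ffun 'I_k -> bool}.

(* Iterated coproduct  Delta(T_ij(x)) = sum_r T_rj(x) (x) T_ir(x), i.e.
   T_ij(x) |-> sum_{r_0 = j, r_k = i} T_{r_1 r_0} (x) T_{r_2 r_1} (x) ... (x) T_{r_k r_{k-1}},
   acting on the super tensor product with the Koszul sign
   (A_1 (x) ... (x) A_k)(v_1 (x) ... (x) v_k)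
     = (-1)^{sum_{t<s} |A_s| |v_t|} A_1 v_1 (x) ... (x) A_k v_k ,
   where |T_{r_{s+1} r_s}| = |r_{s+1}| + |r_s|.  The single-site factor is
   given by the function site s a b o c (the (o,c) entry of T_ab on factor s). *)
Definition tensT (k : nat) (site : 'I_k -> bool -> bool -> bool -> bool -> S)
    (i j : bool) (d c : tbasis k) : S :=
  \sum_(r : {ffun 'I_k.+1 -> bool} | (r ord0 == j) && (r ord_max == i))
    (-1) ^+ (\sum_(s < k) \sum_(t < k | (t < s)%N)
                ((r (lift ord0 s) (+) r (widen_ord (leqnSn k) s)) * c t))%N
    * \prod_(s < k) site s (r (lift ord0 s)) (r (widen_ord (leqnSn k) s)) (d s) (c s).

(* prod_s (x - b_s) T_ij(x) on L(lambda,b): polynomial in x; this is the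
   continuous extension of the rational operator prod_s (x - b_s) T_ij(x). *)
Definition Tnum (k : nat) (l1 l2 b : 'I_k -> S) (i j : bool) (x : S)
    (d c : tbasis k) : S :=
  tensT (fun s a a' o c => evTnum (l1 s) (l2 s) (b s) a a' x o c) i j d c.
End Modules.

Section Operators.
Variable F : fieldType.
Variable k : nat.
Notation N := #|tbasis k|.

Definition Tmx (l1 l2 b : 'I_k -> F) (i j : bool) (x : F) : 'M[F]_N :=
  \matrix_(a, c) (Tnum l1 l2 b i j x (enum_val a) (enum_val c)
                  / \prod_(s < k) (x - b s)).

Definition vacuum {R : pzRingType} : 'cV[R]_N :=
  \col_a ((enum_val a == [ffun => false])%:R).

Definition DQ (l1 l2 b : 'I_k -> F) (q1 q2 : F) : tser F 'M[F]_N :=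
  let T i j x := Tmx l1 l2 b i j x in
  let G := ts_geom (fun x => q2 *: T true true x) in
  ts_mul
    (ts_add
       (ts_sub (@ts_one F _) (ts_tau (fun x => q1 *: T false false x)))
       (ts_mul (ts_mul (ts_tau (fun x => q1 *: T false true x)) G)
               (ts_tau (fun x => q2 *: T true false x))))
    G.

Definition bethe_num (l : nat) (l1 l2 b : 'I_k -> F) : 'cV[{mpoly F[l]}]_N :=
  (\prod_(i < l)
     (\matrix_(a, c) Tnum (fun s => (l1 s)%:MP) (fun s => (l2 s)%:MP)
                          (fun s => (b s)%:MP) false true 'X_i
                          (enum_val a) (enum_val c) : 'M[{mpoly F[l]}]_N))
  *m vacuum.

Definition bethe_den (l : nat) : {mpoly F[l]} :=
  \prod_(i < l) \prod_(j < l | (i < j)%N) ('X_j - 'X_i + 1).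
End Operators.

Definition phi_pol {F : fieldType} (k : nat) (l1 b : 'I_k -> F) : {poly F} :=
  \prod_(s < k) ('X - (b s - l1 s)%:P).
Definition psi_pol {F : fieldType} (k : nat) (l2 b : 'I_k -> F) : {poly F} :=
  \prod_(s < k) ('X - (b s + l2 s)%:P).

Definition BAE {F : fieldType} (k l : nat) (l1 l2 b : 'I_k -> F) (q1 q2 : F)
    (t : 'I_l -> F) : Prop :=
  (\prod_(i < l) ('X - (t i)%:P)) %| (q1 *: phi_pol l1 b - q2 *: psi_pol l2 b).

Definition ypol {F : fieldType} (l : nat) (t : 'I_l -> F) (x : F) : F :=
  \prod_(i < l) (x - t i).
Definition zeta1 {F : fieldType} (k : nat) (l1 b : 'I_k -> F) (x : F) : F :=
  \prod_(s < k) ((x - b s + l1 s) / (x - b s)).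
Definition zeta2 {F : fieldType} (k : nat) (l2 b : 'I_k -> F) (x : F) : F :=
  \prod_(s < k) ((x - b s - l2 s) / (x - b s)).

Definition DQt {F : fieldType} (k l : nat) (l1 l2 b : 'I_k -> F) (q1 q2 : F)
    (t : 'I_l -> F) : tser F F :=
  ts_mul
    (ts_sub (@ts_one F _)
            (ts_tau (fun x => q1 * zeta1 l1 b x * (ypol t (x - 1) / ypol t x))))
    (ts_geom (fun x => q2 * zeta2 l2 b x * (ypol t (x - 1) / ypol t x))).

(* Main.v *)
Require Import Defs.
From HB Require Import structures.
From mathcomp Require Import all_boot all_order all_algebra.
From mathcomp Require Import mpoly.
From mathcomp Require Import ring.
Import GRing.Theory.
Local Open Scope ring_scope.
Set Implicit Arguments.
Unset Strict Implicit.
Unset Printing Implicit Defensive.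

(** Write A, B, C, D for T_11, T_12, T_21, T_22.  An R-matrix intertwines the
  single-site weights of T(x) T(y) and T(y) T(x), hence the RTT relations on the
  tensor product.  In particular A and D have the same exchange relation with B,
  and B(u+1) B(u) = 0.  For generic t this gives, by induction on l, the
  off-shell action of A and D on the normalized Bethe vector, and the action of
  C modulo the kernel of B(u+1); all three are regular at pairwise distinct t,
  so they specialize from the field of rational functions in t.

  With a = q_1 A, b = q_1 B, c = q_2 C, d = q_2 D, the coefficient K_m of tau^m
  in D^Q satisfies, for m >= 1,
    K_(m+1)(x) = K_m(x) d(x-m) + G_m(x) b(x-m+1) c(x-m),
    K_m(x) b(x-m) = G_m(x) b(x-m+1) (d - a)(x-m),
    G_m(x) = d(x) d(x-1) ... d(x-m+2).
  On a Bethe vector at a solution of the Bethe ansatz equation, the unwanted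
  terms of K_m(x) d(x-m) are therefore multiples of G_m(x) b(x-m+1) applied to
  smaller Bethe vectors, and they cancel the contribution of c, which is only
  needed modulo the kernel of b(x-m+1). *)

(** * RTT relations *)

Section PathSums.
Variable S : comPzRingType.

(** An entry of the ordered product of the matrices [w s], site 0 rightmost. The path form is the
    one in which [tensT] is given. *)
Definition pathsum (A : finType) (k : nat) (w : 'I_k -> A -> A -> S) (i j : A) : S :=
  \sum_(r : {ffun 'I_k.+1 -> A} | (r ord0 == j) && (r ord_max == i))
    \prod_(s < k) w s (r (lift ord0 s)) (r (widen_ord (leqnSn k) s)).

Definition ffcons (A : finType) (k : nat) (a : A) (r : {ffun 'I_k -> A}) :
  {ffun 'I_k.+1 -> A} :=
  [ffun s => if unlift ord0 s is Some s' then r s' else a].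

Lemma ffcons0 (A : finType) k a (r : {ffun 'I_k -> A}) : ffcons a r ord0 = a.
Proof. by rewrite ffunE unlift_none. Qed.

Lemma ffconsS (A : finType) k a (r : {ffun 'I_k -> A}) s :
  ffcons a r (lift ord0 s) = r s.
Proof. by rewrite ffunE liftK. Qed.

Lemma sum_ffcons (A : finType) k (P : pred {ffun 'I_k.+1 -> A})
    (G : {ffun 'I_k.+1 -> A} -> S) :
  \sum_(r | P r) G r = \sum_a \sum_(r | P (ffcons a r)) G (ffcons a r).
Proof.
rewrite pair_big_dep /=.
rewrite (reindex (fun p : A * {ffun 'I_k -> A} => ffcons p.1 p.2)) //.
exists (fun r : {ffun 'I_k.+1 -> A} =>
          (r ord0, [ffun s : 'I_k => r (lift ord0 s)])) => [[a r]|r] _ /=.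
  by rewrite ffcons0; congr pair; apply/ffunP => s; rewrite ffunE ffconsS.
by apply/ffunP => s; rewrite ffunE; case: unliftP => [s'|] ->; rewrite ?ffunE.
Qed.

Lemma pathsum0 (A : finType) (w : 'I_0 -> A -> A -> S) i j :
  pathsum w i j = (i == j)%:R.
Proof.
rewrite /pathsum.
under eq_bigr do rewrite big_ord0.
have [<-|neq] := eqVneq i j.
  rewrite (big_pred1 [ffun => i]) // => r /=.
  apply/andP/eqP => [[/eqP r0 _]|->]; last by rewrite !ffunE.
  by apply/ffunP => s; rewrite ffunE ord1.
rewrite big_pred0 // => r; apply/negP => /andP[/eqP r0 /eqP r1].
by move: neq; rewrite -r0 -r1 (_ : ord_max = ord0) ?eqxx //; apply: val_inj.
Qed.

Lemma pathsumS (A : finType) k (w : 'I_k.+1 -> A -> A -> S) i j :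
  pathsum w i j = \sum_a pathsum (fun s => w (lift ord0 s)) i a * w ord0 a j.
Proof.
rewrite /pathsum sum_ffcons (bigD1 j) //= [X in _ + X]big1 ?addr0; last first.
  move=> a /negbTE naj; rewrite big_pred0 // => r.
  by rewrite ffcons0 naj.
under eq_bigr => r _ do rewrite big_ord_recl ffconsS.
under [RHS]eq_bigr => a _.
  rewrite mulr_suml (eq_bigl (fun r : {ffun 'I_k.+1 -> A} =>
    (r ord_max == i) && (r ord0 == a))); last by move=> r; rewrite andbC.
over.
rewrite -[RHS]/(\sum_(a | predT a) _).
transitivity (\sum_(r : {ffun 'I_k.+1 -> A} | r ord_max == i)
   (\prod_(s < k) w (lift ord0 s) (r (lift ord0 s)) (r (widen_ord (leqnSn k) s)))
    * w ord0 (r ord0) j); last first.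
  rewrite (partition_big (fun r : {ffun 'I_k.+1 -> A} => r ord0) predT) //=.
  apply: eq_bigr => a _; apply: eq_bigr => r /andP[_ /eqP ->] //.
apply: eq_big => [r|r _].
  by rewrite ffcons0 eqxx /= (_ : ord_max = lift ord0 ord_max) ?ffconsS //;
     apply: val_inj.
rewrite mulrC; congr (_ * _).
  apply: eq_bigr => s _; rewrite ffconsS; congr (w _ _ _).
  rewrite (_ : widen_ord _ _ = lift ord0 (widen_ord (leqnSn k) s)) ?ffconsS //.
  exact: val_inj.
by congr (w _ _ _); rewrite (_ : widen_ord _ _ = ord0) ?ffcons0 //; apply: val_inj.
Qed.

(* The train argument: an intertwiner of the single-site weights passes through
   the whole monodromy. *)
Lemma pathsum_intertwine (A : finType) k (w w' : 'I_k -> A -> A -> S)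
    (R : A -> A -> S) :
  (forall s i j, \sum_a R i a * w s a j = \sum_a w' s i a * R a j) ->
  forall i j, \sum_a R i a * pathsum w a j = \sum_a pathsum w' i a * R a j.
Proof.
elim: k w w' => [|k IHk] w w' Rw i j.
  rewrite (bigD1 j) //= big1 => [|a /negbTE naj]; last first.
    by rewrite pathsum0 naj mulr0.
  rewrite [RHS](bigD1 i) //= [X in _ = _ + X]big1 => [|a naj]; last first.
    by rewrite pathsum0 eq_sym (negbTE naj) mul0r.
  by rewrite !pathsum0 !eqxx mulr1 mul1r.
under eq_bigr => a _ do rewrite pathsumS mulr_sumr.
under [RHS]eq_bigr => a _ do rewrite pathsumS mulr_suml.
rewrite exchange_big /= [RHS]exchange_big /=.
under eq_bigr => a _.
  under eq_bigr => a' _ do rewrite mulrA.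
  rewrite -mulr_suml (IHk _ (fun s => w' (lift ord0 s))); last first.
    by move=> s *; apply: Rw.
  rewrite mulr_suml.
  under eq_bigr => a' _ do rewrite -mulrA.
  over.
rewrite exchange_big /=; apply: eq_bigr => a _.
by rewrite -mulr_sumr Rw mulr_sumr; apply: eq_bigr => a' _; rewrite mulrA.
Qed.

(** A product of two monodromies runs along two auxiliary paths; they are merged into one path in
    the tensor square, where [braid] acts. *)
Lemma pathsum_pair (A B : finType) k (w : 'I_k -> A * B -> A * B -> S) i j :
  pathsum w i j =
  \sum_(r : {ffun 'I_k.+1 -> A} | (r ord0 == j.1) && (r ord_max == i.1))
  \sum_(r' : {ffun 'I_k.+1 -> B} | (r' ord0 == j.2) && (r' ord_max == i.2))
    \prod_(s < k) w s (r (lift ord0 s), r' (lift ord0 s))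
       (r (widen_ord (leqnSn k) s), r' (widen_ord (leqnSn k) s)).
Proof.
rewrite pair_big /= /pathsum.
rewrite (reindex (fun p : {ffun 'I_k.+1 -> A} * {ffun 'I_k.+1 -> B} =>
   [ffun s => (p.1 s, p.2 s)])) /=; last first.
  exists (fun r : {ffun 'I_k.+1 -> A * B} =>
    ([ffun s => (r s).1], [ffun s => (r s).2])) => [[r r']|r] _ /=.
    by congr pair; apply/ffunP => s; rewrite !ffunE.
  by apply/ffunP => s; rewrite !ffunE; case: (r s).
apply: eq_big => [[r r']|[r r'] _] /=.
  by case: i j => [i i'] [j j']; rewrite !ffunE !xpair_eqE andbACA.
by apply: eq_bigr => s _; rewrite !ffunE.
Qed.

End PathSums.

(** * The monodromy matrix and its RTT relation *)

Section Monodromy.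
Variable S : comPzRingType.

Lemma prod_signr_telescope (f : nat -> bool) m n : (m <= n)%N ->
  \prod_(s < n | (m <= s)%N) (-1) ^+ (f s.+1 (+) f s) = (-1) ^+ (f n (+) f m) :> S.
Proof.
rewrite -(big_geq_mkord _ _ xpredT (fun s => (-1) ^+ (f s.+1 (+) f s) : S)).
elim: n => [|n IHn]; first by rewrite leqn0 => /eqP->; rewrite big_geq // addbb.
rewrite leq_eqVlt => /predU1P[->|]; first by rewrite big_geq // addbb.
rewrite ltnS => le_mn; rewrite big_nat_recr //= IHn // -signr_addb.
by congr (_ ^+ nat_of_bool _); case: (f m) (f n) (f n.+1) => [] [] [].
Qed.

Lemma prod_signr_path k (r : {ffun 'I_k.+1 -> bool}) (m : 'I_k.+1) :
  \prod_(s < k | (m <= s)%N)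
     (-1) ^+ (r (lift ord0 s) (+) r (widen_ord (leqnSn k) s))
  = (-1) ^+ (r ord_max (+) r m) :> S.
Proof.
(* The path is read as a sequence on the naturals, to which telescoping applies; only its values up
   to [k] matter. *)
pose f n := r (inord n).
have := @prod_signr_telescope f m k (ltn_ord m).
have -> : f m = r m by rewrite /f inord_val.
have -> : f k = r ord_max by congr (r _); apply: val_inj; rewrite /= inordK.
move=> <-; apply: eq_bigr => s _; congr (_ ^+ nat_of_bool (r _ (+) r _)); apply: val_inj.
  by rewrite /= inordK // ltnS.
by rewrite /= inordK // ltnS ltnW.
Qed.

(* The parities of the path steps to the right of a site telescope, so the
   Koszul sign is a product of single-site signs. *)
Lemma tensT_pathsum k (site : 'I_k -> bool -> bool -> bool -> bool -> S) i j d c :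
  tensT site i j d c =
  pathsum (fun s a a' => (-1) ^+ (c s && (i (+) a)) * site s a a' (d s) (c s)) i j.
Proof.
apply: eq_bigr => r /andP[_ /eqP ri].
rewrite big_split /=; congr (_ * _).
rewrite -prodrXr.
under eq_bigr do rewrite -prodrXr.
rewrite (exchange_big_dep predT) //=; apply: eq_bigr => t _.
case: (c t); last by rewrite /= big1 // => s _; rewrite muln0.
under eq_bigr do rewrite muln1.
by rewrite -ri -(prod_signr_path r (lift ord0 t)).
Qed.

(* The weight of one site in a product T(x) T(y), seen as an operator on the
   tensor square of the auxiliary space. *)
Definition evTT (l1 l2 z x y : S) (d c : bool) (a b : bool * bool) : S :=
  \sum_(e : bool) (-1) ^+ (e && a.1) * (-1) ^+ (c && a.2)
    * evTnum l1 l2 z a.1 b.1 x d e * evTnum l1 l2 z a.2 b.2 y e c.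

(** This is u P R(u) = u P + 1, with P the graded flip: the factor u clears the pole of the
    R-matrix. *)
Definition braid (u : S) (a b : bool * bool) : S :=
  (u * (-1) ^+ (a.1 && a.2)) * (b == (a.2, a.1))%:R + (b == a)%:R.

Lemma sum_bool_pair (f : bool * bool -> S) :
  \sum_a f a = f (false, false) + f (false, true) + f (true, false) + f (true, true).
Proof.
rewrite (eq_bigr (fun p => f (p.1, p.2))); last by case.
by rewrite -(pair_bigA _ (fun a b => f (a, b))) /= !big_bool /=; ring.
Qed.

(** For a single evaluation site the relation is one polynomial identity for each of the 64 choices
    of parities. *)
Lemma evTT_braid (l1 l2 z x y : S) d c i j :
  \sum_a braid (x - y) i a * evTT l1 l2 z x y d c a j =
  \sum_a evTT l1 l2 z y x d c i a * braid (x - y) a j.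
Proof.
rewrite !sum_bool_pair /evTT /braid !big_bool /evTnum /glact.
by case: i j d c => [[] []] [[] []] [] [] /=; ring.
Qed.

(* [evTnum a a' _ e c] vanishes unless [e = c + a + a'] as parities, which turns
   the Koszul signs depending on the intermediate state into boundary signs. *)
Lemma evTT_sign (l1 l2 z x y : S) i r d c (a a' b b' : bool) :
  \sum_e ((-1) ^+ (e && (i (+) a)) * evTnum l1 l2 z a a' x d e)
       * ((-1) ^+ (c && (r (+) b)) * evTnum l1 l2 z b b' y e c)
  = ((-1) ^+ (i && (b (+) b')) * (-1) ^+ ((i (+) r) && c))
    * evTT l1 l2 z x y d c (a, b) (a', b').
Proof.
rewrite /evTT !big_bool /=.
move: (evTnum l1 l2 z a a' x d) => f; rewrite /evTnum /glact.
by case: i r c a b b' => [] [] [] [] [] [] /=; ring.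
Qed.

(** By distributivity the sum over intermediate states is a product over sites. The signs left over
    by [evTT_sign] either telescope along the second path or depend on [c] alone. *)
Lemma Tnum_mul k (l1 l2 z : 'I_k -> S) i j r s x y d c :
  \sum_e Tnum l1 l2 z i j x d e * Tnum l1 l2 z r s y e c
  = (-1) ^+ (i && (r (+) s)) * (\prod_t (-1) ^+ ((i (+) r) && c t))
    * pathsum (fun t => evTT (l1 t) (l2 t) (z t) x y (d t) (c t)) (i, r) (j, s).
Proof.
rewrite /Tnum pathsum_pair /=.
under eq_bigr => e _ do rewrite !tensT_pathsum /pathsum mulr_suml.
rewrite exchange_big mulr_sumr /=; apply: eq_bigr => p /andP[_ /eqP pi].
under eq_bigr => e _ do rewrite mulr_sumr.
rewrite exchange_big mulr_sumr /=; apply: eq_bigr => p' /andP[/eqP p's /eqP p'r].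
under eq_bigr => e _ do rewrite -big_split /=.
pose G t e := ((-1) ^+ (e && (i (+) p (lift ord0 t)))
     * evTnum (l1 t) (l2 t) (z t) (p (lift ord0 t)) (p (widen_ord (leqnSn k) t)) x (d t) e)
   * ((-1) ^+ (c t && (r (+) p' (lift ord0 t)))
     * evTnum (l1 t) (l2 t) (z t) (p' (lift ord0 t)) 
       (p' (widen_ord (leqnSn k) t)) y e (c t)).
rewrite -(bigA_distr_bigA G) /G {G}.
under eq_bigr => t _ do rewrite evTT_sign.
rewrite !big_split /= -p'r -p's; congr (_ * _ * _).
case: i pi => _; last by rewrite big1.
by rewrite -(prod_signr_path p' ord0).
Qed.

(** Without denominators the operators make sense over polynomial rings and commute with ring
    morphisms. *)
Definition Tn k (l1 l2 z : 'I_k -> S) i j x : 'M[S]_#|tbasis k| :=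
  \matrix_(a, c) Tnum l1 l2 z i j x (enum_val a) (enum_val c).

Lemma Tn_mulE k (l1 l2 z : 'I_k -> S) i j r s x y a c :
  (Tn l1 l2 z i j x *m Tn l1 l2 z r s y) a c =
  (-1) ^+ (i && (r (+) s)) * (\prod_t (-1) ^+ ((i (+) r) && enum_val c t))
    * pathsum (fun t => evTT (l1 t) (l2 t) (z t) x y (enum_val a t) (enum_val c t))
        (i, r) (j, s).
Proof.
rewrite mxE -Tnum_mul (big_enum_val (A := predT)
  (fun e => Tnum l1 l2 z i j x (enum_val a) e * Tnum l1 l2 z r s y e (enum_val c))) /=.
by apply: eq_bigr => e _; rewrite !mxE.
Qed.

Lemma RTT k (l1 l2 z : 'I_k -> S) i j r s x y :
  let T := Tn l1 l2 z in
  ((x - y) * (-1) ^+ (r && s)) *: (T r j x *m T i s y)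
    + (-1) ^+ ((i && r) (+) (i && s)) *: (T i j x *m T r s y)
  = ((x - y) * (-1) ^+ ((j && s) (+) (i && r) (+) (i && j))) *: (T i s y *m T r j x)
    + (-1) ^+ ((i && r) (+) (i && s)) *: (T i j y *m T r s x).
Proof.
move=> T; apply/matrixP => a c.
rewrite /T 2![in LHS]mxE 2![in RHS]mxE.
rewrite [X in _ + X = _]mxE [X in _ = _ + X]mxE !Tn_mulE.
set e := enum_val c; set d := enum_val a.
(* All four products now carry the same state-dependent sign [E], which factors out of the relation
   given by the intertwiner. *)
rewrite (addbC r i).
have /= := pathsum_intertwine (fun t => evTT_braid (l1 t) (l2 t) (z t) x y (d t) (e t))
  (i, r) (j, s).
set W := pathsum _; set W' := pathsum _; set E := \prod_t _.
rewrite !sum_bool_pair /braid => /= H.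
have {}H : (x - y) * (-1) ^+ (i && r) * W (r, i) (j, s) + W (i, r) (j, s)
  = (x - y) * (-1) ^+ (j && s) * W' (i, r) (s, j) + W' (i, r) (j, s).
  case: i j r s H {E} => [] [] [] [] /= H; by apply: etrans (etrans H _); ring.
set w1 := W (r, i) _ in H *; set w2 := W (i, r) _ in H *.
set w3 := W' (i, r) (s, j) in H *; set w4 := W' (i, r) (j, s) in H *.
transitivity (E * ((x - y) * (-1) ^+ (i && r) * w1 + w2)).
  by case: (i) (j) (r) (s) => [] [] [] [] /=; ring.
by rewrite H; case: (i) (j) (r) (s) => [] [] [] [] /=; ring.
Qed.

End Monodromy.

(** Reduces deriving one linear relation from another to a ring identity between the differences of
    their sides. *)
Lemma eq_of_subr (V : zmodType) (a b c d : V) : c = d -> a - b = c - d -> a = b.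
Proof. by move=> -> /eqP; rewrite subrr subr_eq0 => /eqP. Qed.

(** * Exchange relations among A, B, C and D *)

Section Relations.
Variables (S : comPzRingType) (k : nat) (l1 l2 z : 'I_k -> S).
Notation A := (Tn l1 l2 z false false).
Notation B := (Tn l1 l2 z false true).
Notation C := (Tn l1 l2 z true false).
Notation D := (Tn l1 l2 z true true).

Lemma Tn_BB x y : (x - y + 1) *: (B x *m B y) = (y - x + 1) *: (B y *m B x).
Proof.
have /= := RTT l1 l2 z false true false true x y.
move: (B x *m B y) (B y *m B x) => p q H; apply/matrixP => a c.
by move/matrixP/(_ a c): H; rewrite !mxE => H; apply: (eq_of_subr H); ring.
Qed.

Lemma Tn_AB x y :
  (x - y) *: (A x *m B y) = (x - y - 1) *: (B y *m A x) + B x *m A y.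
Proof.
have /= := RTT l1 l2 z false true false false y x.
move: (A x *m B y) (B y *m A x) (B x *m A y) => p q r H; apply/matrixP => a c.
by move/matrixP/(_ a c): H; rewrite !mxE => H; apply: (eq_of_subr H); ring.
Qed.

Lemma Tn_DB x y :
  (x - y) *: (D x *m B y) = (x - y - 1) *: (B y *m D x) + B x *m D y.
Proof.
have /= := RTT l1 l2 z false true true true x y.
move: (D x *m B y) (B y *m D x) (B x *m D y) => p q r H.
apply/matrixP => a c.
by move/matrixP/(_ a c): H; rewrite !mxE => H; apply: (eq_of_subr (esym H)); ring.
Qed.

Lemma Tn_CB x y :
  (x - y) *: (C x *m B y + B y *m C x) = A x *m D y - A y *m D x.
Proof.
have /= := RTT l1 l2 z false false true true x y.
move: (C x *m B y) (B y *m C x) (A x *m D y) (A y *m D x) => p q r t H.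
apply/matrixP => a c.
by move/matrixP/(_ a c): H; rewrite !mxE => H; apply: (eq_of_subr (esym H)); ring.
Qed.

(** Unlike [Tn_CB], this puts [B] at the upper point to the left of [C], where a preceding
    [B (x + 1)] annihilates it. *)
Lemma Tn_CB_shift x :
  C x *m B (x - 1) = A x *m D (x - 1) - D x *m A (x - 1) - B x *m C (x - 1).
Proof.
have /= := RTT l1 l2 z true true false false x (x - 1).
have /= := RTT l1 l2 z true false false true x (x - 1).
move: (C x *m B _) (A x *m D _) (D x *m A _) (B x *m C _) (D _ *m A x) (C _ *m B x).
move=> p q r t u v H1 H2; apply/matrixP => a c.
move/matrixP/(_ a c): H1; move/matrixP/(_ a c): H2; rewrite !mxE => H1 H2.
(* The difference of the two instances eliminates [D (x - 1) *m A x] and [C (x - 1) *m B x]. *)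
have {H1 H2}H := congr2 (fun g h => g - h) H1 H2.
by apply: (eq_of_subr H); ring.
Qed.

End Relations.

(** * Vacuum vector and change of rings *)

Section Vacuum.
Variable S : comPzRingType.

(** On the vacuum each site weight is triangular, because e_12 kills the highest weight vector;
    diagonal entries of triangular matrices multiply. *)
Lemma pathsum_triangular k (w : 'I_k -> bool -> bool -> S) :
  (forall s, w s true false = 0) ->
  pathsum w true false = 0 /\ forall b, pathsum w b b = \prod_s w s b b.
Proof.
elim: k w => [|k IHk] w w0.
  by split=> [|b]; rewrite pathsum0 ?big_ord0 ?eqxx.
have [IH0 IH1] := IHk (fun s => w (lift ord0 s)) (fun s => w0 _).
split=> [|[]]; rewrite pathsumS big_bool /= IH1 ?IH0 ?w0 ?big_ord_recl.
- by rewrite mulr0 mul0r addr0.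
- by rewrite mul0r addr0 mulrC.
- by rewrite mulr0 add0r mulrC.
Qed.

Variables (k : nat) (l1 l2 z : 'I_k -> S).

Definition phi (x : S) : S := \prod_s (x - z s + l1 s).
Definition psi (x : S) : S := \prod_s (x - z s - l2 s).

Let vac : tbasis k := [ffun=> false].

Lemma Tnum_vac_upper x d : Tnum l1 l2 z true false x d vac = 0.
Proof.
rewrite /Tnum tensT_pathsum; apply: (pathsum_triangular _).1 => s.
by rewrite ffunE /evTnum /= andbF /= !mulr0 addr0 mulr0.
Qed.

Lemma Tnum_vac_diag b x d : Tnum l1 l2 z b b x d vac =
  (if b then psi x else phi x) * (d == vac)%:R.
Proof.
rewrite /Tnum tensT_pathsum (pathsum_triangular _).2 => [|s]; last first.
  by rewrite ffunE /evTnum /= andbF /= !mulr0 addr0 mulr0.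
have -> : (d == vac)%:R = \prod_s (d s == false)%:R :> S.
  have [->|ndv] := eqVneq d vac; first by rewrite big1 // => s _; rewrite ffunE.
  have [s ds] : exists s, d s.
    apply/existsP; apply: contraNT ndv => /existsPn nd.
    by apply/eqP/ffunP => s; rewrite ffunE; apply/negbTE/nd.
  by rewrite (bigD1 s) //= ds mul0r.
rewrite [if b then _ else _](_ : _ =
   \prod_s (if b then x - z s - l2 s else x - z s + l1 s)); last by case: b.
rewrite -big_split; apply: eq_bigr => s _ /=.
by rewrite ffunE /evTnum /glact; case: b; case: (d s) => /=; ring.
Qed.

Lemma Tn_vacE i j x a : (Tn l1 l2 z i j x *m @vacuum k S) a 0 =
  Tnum l1 l2 z i j x (enum_val a) vac.
Proof.
rewrite mxE (bigD1 (enum_rank vac)) //= !mxE enum_rankK eqxx mulr1.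
rewrite big1 ?addr0 // => c ncv; rewrite !mxE.
have /negbTE-> : enum_val c != vac; last by rewrite mulr0.
by apply: contra_neq ncv => <-; rewrite enum_valK.
Qed.

Lemma Tn_A_vac x : Tn l1 l2 z false false x *m @vacuum k S = phi x *: @vacuum k S.
Proof.
by apply/matrixP => a j; rewrite ord1 Tn_vacE (Tnum_vac_diag false) !mxE.
Qed.

Lemma Tn_D_vac x : Tn l1 l2 z true true x *m @vacuum k S = psi x *: @vacuum k S.
Proof.
by apply/matrixP => a j; rewrite ord1 Tn_vacE (Tnum_vac_diag true) !mxE.
Qed.

Lemma Tn_C_vac x : Tn l1 l2 z true false x *m @vacuum k S = 0.
Proof. by apply/matrixP => a j; rewrite ord1 Tn_vacE Tnum_vac_upper !mxE. Qed.

End Vacuum.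

Section Morphism.
Variables (S S' : comPzRingType) (f : {rmorphism S -> S'}).

(** The entries are polynomial in the weights, the points and [x]. This serves substitution,
    evaluation and passage to fractions alike. *)
Lemma map_Tn k (l1 l2 z : 'I_k -> S) (l1' l2' z' : 'I_k -> S') i j x :
  (forall s, f (l1 s) = l1' s) -> (forall s, f (l2 s) = l2' s) ->
  (forall s, f (z s) = z' s) ->
  map_mx f (Tn l1 l2 z i j x) = Tn l1' l2' z' i j (f x).
Proof.
move=> fl1 fl2 fz; apply/matrixP => a c; rewrite !mxE /Tnum /tensT rmorph_sum.
apply: eq_bigr => r _; rewrite rmorphM rmorph_sign rmorph_prod; congr (_ * _).
apply: eq_bigr => s _; rewrite /evTnum rmorphD !rmorphM rmorphB rmorph_nat rmorph_sign.
rewrite fz -fl1 -fl2; congr (_ + _ * _).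
move: (r _) (r _) (enum_val a s) (enum_val c s).
by case=> [] [] [] [] /=; rewrite ?(rmorph0, rmorph1, rmorphD, rmorphN, subr0).
Qed.

Lemma map_vacuum k : map_mx f (@vacuum k S) = @vacuum k S'.
Proof. by apply/matrixP => a j; rewrite !mxE rmorph_nat. Qed.

End Morphism.

(** * Off-shell action on Bethe vectors *)

Section SumDel.
Variable T : eqType.

(* The sum of [f i (I without i)] over the positions of [i] in [I]. *)
Fixpoint sumdel (V : nmodType) (f : T -> seq T -> V) (I : seq T) : V :=
  if I is i :: I' then f i I' + sumdel (fun j J => f j (i :: J)) I' else 0.

Lemma eq_sumdel (V : nmodType) (f g : T -> seq T -> V) I :
  (forall j J, perm_eq (j :: J) I -> f j J = g j J) -> sumdel f I = sumdel g I.
Proof.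
elim: I f g => //= i I IHI f g fg; congr (_ + _); first exact: fg.
apply: IHI => j J pI; apply: fg.
rewrite -(perm_cons i) in pI; apply: perm_trans pI.
by apply/permP => p /=; rewrite addnCA.
Qed.

Lemma sumdel_add (V : nmodType) (f g : T -> seq T -> V) I :
  sumdel (fun j J => f j J + g j J) I = sumdel f I + sumdel g I.
Proof.
by elim: I f g => [|i I IHI] f g /=; rewrite ?addr0 // IHI addrACA.
Qed.

Lemma raddf_sumdel (U V : nmodType) (h : {additive U -> V}) (f : T -> seq T -> U) I :
  h (sumdel f I) = sumdel (fun j J => h (f j J)) I.
Proof. by elim: I f => [|i I IHI] f /=; rewrite ?raddf0 // raddfD IHI. Qed.

Lemma sumdel_sub (V : zmodType) (f g : T -> seq T -> V) I :
  sumdel (fun j J => f j J - g j J) I = sumdel f I - sumdel g I.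
Proof.
elim: I f g => [|i I IHI] f g /=; first by rewrite subr0.
by rewrite IHI opprD addrACA.
Qed.

Lemma sumdel0 (V : nmodType) I : sumdel (fun _ _ => 0 : V) I = 0.
Proof. by elim: I => //= i I ->; rewrite addr0. Qed.
End SumDel.

Section SumDelMx.
Variables (T : eqType) (R : comPzRingType).
Lemma mulmx_sumdel m n p (M : 'M[R]_(m, n)) (f : T -> seq T -> 'M[R]_(n, p)) I :
  M *m sumdel f I = sumdel (fun j J => M *m f j J) I.
Proof. exact: (raddf_sumdel (mulmx M)). Qed.
Lemma scale_sumdel (V : lmodType R) (c : R) (f : T -> seq T -> V) I :
  c *: sumdel f I = sumdel (fun j J => c *: f j J) I.
Proof. exact: (raddf_sumdel ( *:%R c)). Qed.
End SumDelMx.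

(** * Exclusion principle for B *)

Section Exclusion.
Variables (S : idomainType) (N : nat) (B : S -> 'M[S]_N).
Hypothesis two_neq0 : 2%:R != 0 :> S.
Hypothesis BB : forall x y, (x - y + 1) *: (B x *m B y) = (y - x + 1) *: (B y *m B x).

(** At spacing 1 one coefficient of [BB] vanishes and the other is 2. *)
Lemma BB_shift x : B (x + 1) *m B x = 0.
Proof.
have := BB (x + 1) x; rewrite (_ : x - (x + 1) + 1 = 0) ?scale0r; last by ring.
rewrite (_ : x + 1 - x + 1 = 2%:R); last by ring.
by move/eqP; rewrite scalemx_eq0 (negbTE two_neq0) => /eqP.
Qed.

Lemma BB_annihilate x y (v : 'cV[S]_N) :
  x - y + 1 != 0 -> B x *m v = 0 -> B x *m (B y *m v) = 0.
Proof.
move=> xy Bv; apply/eqP; have /eqP := congr1 (fun M => M *m v) (BB x y).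
by rewrite -!scalemxAl -!mulmxA Bv mulmx0 scaler0 scalemx_eq0 (negbTE xy).
Qed.
End Exclusion.

Section OffShell.
Variables (K : fieldType) (N : nat) (T : eqType) (t : T -> K).
Variables (A B C D : K -> 'M[K]_N) (vac : 'cV[K]_N) (phi psi : K -> K).
Hypothesis two_neq0 : 2%:R != 0 :> K.
Hypothesis BB : forall x y, (x - y + 1) *: (B x *m B y) = (y - x + 1) *: (B y *m B x).
Definition exchange (X : K -> 'M[K]_N) := forall x y,
  (x - y) *: (X x *m B y) = (x - y - 1) *: (B y *m X x) + B x *m X y.
Hypothesis AB : exchange A.
Hypothesis DB : exchange D.
Hypothesis CB : forall x y,
  (x - y) *: (C x *m B y + B y *m C x) = A x *m D y - A y *m D x.
Hypothesis Avac : forall x, A x *m vac = phi x *: vac.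
Hypothesis Dvac : forall x, D x *m vac = psi x *: vac.
Hypothesis Cvac : forall x, C x *m vac = 0.

Definition shift_prod x I : K := \prod_(j <- I) (t j - x + 1).
(** Each index contributes its share of the normalization. Indexing by lists provides the smaller
    Bethe vectors of the unwanted terms. *)
Fixpoint bethe_vec (I : seq T) : 'cV[K]_N :=
  if I is i :: I' then (shift_prod (t i) I')^-1 *: (B (t i) *m bethe_vec I') else vac.

(** With y the monic polynomial whose roots are the [t j], this is y(x-1)/y(x), the factor of the
    wanted term. *)
Definition alpha x I : K := \prod_(j <- I) ((x - t j - 1) / (x - t j)).
Definition delta x I : K := \prod_(j <- I) (t j - x).
(** The coefficient of an unwanted term, up to its weight function. Its poles are at coinciding
    points only, so it specializes to distinct points even where t_j - t_i + 1 vanishes. *)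
Definition mu x i I : K := ((x - t i) * delta (t i) I)^-1.

(** At spacing 1 the coefficient x - y - 1 vanishes. *)
Lemma exchange_shift X : exchange X -> forall x, X (x + 1) *m B x = B (x + 1) *m X x.
Proof.
move=> XB x; have := XB (x + 1) x.
by rewrite (addrC x) addrK subrr scale0r add0r scale1r.
Qed.

Hypothesis t_neq : forall i j, i != j -> t i - t j != 0.
Hypothesis t_shift : forall i j, i != j -> t i - t j + 1 != 0.

Lemma shift_prod_neq0 i I : i \notin I -> shift_prod (t i) I != 0.
Proof.
move=> iI; rewrite /shift_prod prodf_seq_neq0; apply/allP => j jI /=.
by apply: t_shift; apply: contraNneq iI => <-.
Qed.

Lemma delta_neq0 i I : i \notin I -> delta (t i) I != 0.
Proof.
move=> iI; rewrite /delta prodf_seq_neq0; apply/allP => j jI /=.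
by apply: t_neq; apply: contraNneq iI => <-.
Qed.

Lemma alpha_delta i I : alpha (t i) I = shift_prod (t i) I / delta (t i) I.
Proof.
rewrite /alpha /shift_prod /delta -prodf_div; apply: eq_bigr => j _.
by rewrite -mulrNN -invrN; congr (_ / _); ring.
Qed.

(** Exchanging [X x] with the leading [B (t i)] leaves [X x] and [X (t i)] acting on the tail, so
    the induction hypothesis is used at both points. *)
Lemma bethe_vec_exchange X f x I : exchange X -> (forall x, X x *m vac = f x *: vac) ->
  uniq I -> (forall i, i \in I -> x - t i != 0) ->
  X x *m bethe_vec I = (f x * alpha x I) *: bethe_vec I
   + sumdel (fun j J => (f (t j) * mu x j J) *: (B x *m bethe_vec J)) I.
Proof.
move=> XB Xvac; elim: I x => [|i I IHI] x /=.
  by move=> _ _; rewrite Xvac /alpha big_nil mulr1 addr0.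
move=> /andP[iI uI] xI.
have xi : x - t i != 0 by apply: xI; rewrite inE eqxx.
have {}xI j : j \in I -> x - t j != 0 by move=> jI; apply: xI; rewrite inE jI orbT.
have pi0 := shift_prod_neq0 iI; have di0 := delta_neq0 iI.
have tiI j : j \in I -> t i - t j != 0.
  by move=> jI; apply: t_neq; apply: contraNneq iI => ->.
rewrite -scalemxAr mulmxA.
have -> : X x *m B (t i) = (x - t i)^-1 *:
    ((x - t i - 1) *: (B (t i) *m X x) + B x *m X (t i)).
  by rewrite -XB scalerA mulVf // scale1r.
rewrite -scalemxAl mulmxDl -scalemxAl -!mulmxA (IHI x uI xI) (IHI (t i) uI tiI).
rewrite !mulmxDr !mulmx_sumdel -!scalemxAr !scalerDr !scale_sumdel !scalerA addrACA -addrA.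
congr (_ + _).
  by congr (_ *: _); rewrite /alpha big_cons -/(alpha x I); field; rewrite ?xi ?pi0.
congr (_ + _).
  by congr (_ *: _); rewrite alpha_delta /mu; field; rewrite ?xi ?di0 ?pi0.
rewrite -sumdel_add; apply: eq_sumdel => j J pI.
have jI : j \in I by rewrite -(perm_mem pI) inE eqxx.
have iJ : i \notin J.
  by apply: contra iI => iJ; rewrite -(perm_mem pI) inE iJ orbT.
have jJ : j \notin J by move: uI; rewrite -(perm_uniq pI) => /andP[].
have pJ0 := shift_prod_neq0 iJ; have dJ0 := delta_neq0 jJ.
have tij0 := tiI _ jI; have xj := xI _ jI.
have tji : t j - t i + 1 != 0.
  by apply: t_shift; apply: contraNneq iI => <-.
have -> : shift_prod (t i) I = (t j - t i + 1) * shift_prod (t i) J.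
  by rewrite /shift_prod -(perm_big _ pI) big_cons.
have -> : mu x j (i :: J) = ((x - t j) * ((t i - t j) * delta (t j) J))^-1.
  by rewrite /mu /delta big_cons.
rewrite -!scalemxAr !mulmxA !scalerA.
(* The two families of unwanted terms contain [B] at x and at [t i] in opposite orders; reordering
   one makes them multiples of the same vector, and a rational identity remains. *)
have BxBt : (x - t i - 1) *: (B (t i) *m B x) = - (x - t i + 1) *: (B x *m B (t i)).
  by rewrite scaleNr BB -scaleNr; congr (_ *: _); ring.
have {}BxBt v a b : (a * (x - t i - 1) * b) *: (B (t i) *m B x *m v) =
    (a * b * - (x - t i + 1)) *: (B x *m B (t i) *m v).
  by rewrite mulrAC -!scalerA (scalemxAl (_ - _)) BxBt -scalemxAl.
rewrite BxBt -scalerDl.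
by congr (_ *: _); rewrite /mu; field; rewrite ?xi ?pJ0 ?dJ0 ?tij0 ?xj ?tji.
Qed.

(** * Actions modulo the kernel of B(u + 1) *)

Section Annihilated.
Variable u : K.
Notation P := (B (u + 1)).

Lemma bethe_vec_exchange_mod X f I : exchange X -> (forall x, X x *m vac = f x *: vac) ->
  uniq I -> (forall i, i \in I -> u - t i != 0) ->
  P *m (X u *m bethe_vec I) = (f u * alpha u I) *: (P *m bethe_vec I).
Proof.
move=> XB Xvac uI uI0; rewrite (bethe_vec_exchange XB Xvac uI uI0) mulmxDr.
rewrite -scalemxAr mulmx_sumdel.
rewrite (@eq_sumdel _ _ _ (fun _ _ => 0)) ?sumdel0 ?addr0 // => j J _.
by rewrite -scalemxAr mulmxA (BB_shift two_neq0 BB) mul0mx scaler0.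
Qed.

Lemma PB y : (u - y + 2%:R) *: (P *m B y) = (y - u) *: (B y *m P).
Proof.
rewrite (_ : u - y + 2%:R = u + 1 - y + 1); last by ring.
by rewrite BB; congr (_ *: _); ring.
Qed.

(** Of the two exchange terms, the one starting with [B u] is annihilated by [P]; the same happens
    in [PXBu]. *)
Lemma PXB X y : exchange X ->
  (u - y) *: (P *m X u *m B y) = (u - y - 1) *: (P *m B y *m X u).
Proof.
move=> XB; rewrite -!mulmxA scalemxAr XB mulmxDr -scalemxAr.
by rewrite [P *m (B u *m _)]mulmxA (BB_shift two_neq0 BB) mul0mx addr0.
Qed.

Lemma PXBu X y : exchange X ->
  (y - u) *: (P *m X y *m B u) = P *m B y *m X u.
Proof.
move=> XB; rewrite -!mulmxA scalemxAr XB mulmxDr -scalemxAr.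
by rewrite [P *m (B u *m _)]mulmxA (BB_shift two_neq0 BB) mul0mx scaler0 add0r.
Qed.

(** Induction on [I]: moving [C u] past the head by [CB] gives products of A and D, handled by the
    off-shell formulas, and a term in [C u] on the tail. The factor u - t_i + 2 comes from moving
    [P] past [B (t i)]. *)
Lemma bethe_vec_C_mod I : uniq I ->
  (forall i, i \in I -> u - t i != 0) -> (forall i, i \in I -> u - t i + 2%:R != 0) ->
  P *m (C u *m bethe_vec I) =
  sumdel (fun j J => ((phi u * psi (t j) - phi (t j) * psi u) * mu u j J * alpha u J)
                     *: (P *m bethe_vec J)) I.
Proof.
elim: I => [|i I IHI] /=; first by rewrite Cvac mulmx0.
move=> /andP[iI uI] uI0 uI2.
have ui : u - t i != 0 by apply: uI0; rewrite inE eqxx.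
have ui2 : u - t i + 2%:R != 0 by apply: uI2; rewrite inE eqxx.
have {}uI0 j : j \in I -> u - t j != 0 by move=> jI; apply: uI0; rewrite inE jI orbT.
have {}uI2 j : j \in I -> u - t j + 2%:R != 0.
  by move=> jI; apply: uI2; rewrite inE jI orbT.
have pi0 := shift_prod_neq0 iI; have di0 := delta_neq0 iI.
have tiI j : j \in I -> t i - t j != 0.
  by move=> jI; apply: t_neq; apply: contraNneq iI => ->.
set y := t i in ui ui2 *.
have PBy : P *m B y = (- (u - y) / (u - y + 2%:R)) *: (B y *m P).
  apply: (scalerI ui2); rewrite PB scalerA; congr (_ *: _).
  by field; rewrite ?ui2.
have CBy : C u *m B y = (u - y)^-1 *: (A u *m D y - A y *m D u) - B y *m C u.
  by rewrite -CB scalerA mulVf // scale1r addrK.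
have PXB' X : exchange X -> P *m X u *m B y = ((u - y - 1) / (u - y)) *: (P *m B y *m X u).
  move=> XB; apply: (scalerI ui); rewrite PXB // scalerA; congr (_ *: _).
  by field; rewrite ?ui.
have PXBu' X : exchange X -> P *m X y *m B u = (- (u - y)^-1) *: (P *m B y *m X u).
  move=> XB; apply: (scalerI ui); rewrite -PXBu // scalerA mulrN mulfV //.
  by rewrite scaleN1r -scaleNr opprB.
(* Once [P] is carried to the right of [B y], the action of [X u] modulo its kernel is available on
   the tail. *)
have PBX X f J : exchange X -> (forall x, X x *m vac = f x *: vac) ->
    uniq J -> (forall j, j \in J -> u - t j != 0) ->
    P *m B y *m X u *m bethe_vec J = (f u * alpha u J) *: (P *m B y *m bethe_vec J).
  move=> XB Xvac uJ uJ0; rewrite PBy -!scalemxAl -!mulmxA.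
  rewrite (bethe_vec_exchange_mod XB Xvac uJ uJ0).
  by rewrite -scalemxAr !scalerA mulrC.
have subJ j J : perm_eq (j :: J) I -> [/\ uniq J, forall j', j' \in J -> u - t j' != 0,
    j \in I, j \notin J & i \notin J].
  move=> pI; split.
  - by move: uI; rewrite -(perm_uniq pI) => /andP[].
  - by move=> j' j'J; apply: uI0; rewrite -(perm_mem pI) inE j'J orbT.
  - by rewrite -(perm_mem pI) inE eqxx.
  - by move: uI; rewrite -(perm_uniq pI) => /andP[].
  - by apply: contra iI => iJ; rewrite -(perm_mem pI) inE iJ orbT.
have PAD : P *m (A u *m (D y *m bethe_vec I)) =
    (psi y * alpha y I * (phi u * alpha u I)) *: (P *m bethe_vec I) + sumdel (fun j J =>
     (psi (t j) * mu y j J * ((u - y - 1) / (u - y) * (phi u * alpha u J)))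
       *: (P *m B y *m bethe_vec J)) I.
  rewrite (bethe_vec_exchange DB Dvac uI tiI) !mulmxDr -!scalemxAr.
  rewrite (bethe_vec_exchange_mod AB Avac uI uI0).
  rewrite scalerA !mulmx_sumdel; congr (_ + _); apply: eq_sumdel => j J /subJ[uJ uJ0 _ _ _].
  rewrite -!scalemxAr !mulmxA PXB' // -scalemxAl (PBX _ _ _ AB Avac uJ uJ0) !scalerA.
  by rewrite !mulrA.
have PAD' : P *m (A y *m (D u *m bethe_vec I)) =
    (psi u * alpha u I * (phi y * alpha y I)) *: (P *m bethe_vec I) + sumdel (fun j J =>
     (psi u * alpha u I * (phi (t j) * mu y j J)
      + psi (t j) * mu u j J * (- (u - y)^-1 * (phi u * alpha u J)))
       *: (P *m B y *m bethe_vec J)) I.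
  rewrite (bethe_vec_exchange DB Dvac uI uI0) !mulmxDr -!scalemxAr.
  rewrite (bethe_vec_exchange AB Avac uI tiI).
  rewrite mulmxDr -scalemxAr scalerDr scalerA -addrA !mulmx_sumdel scale_sumdel -sumdel_add.
  congr (_ + _); apply: eq_sumdel => j J /subJ[uJ uJ0 _ _ _].
  rewrite -!scalemxAr !mulmxA PXBu' // -scalemxAl (PBX _ _ _ AB Avac uJ uJ0) !scalerA.
  by rewrite -scalerDl !mulrA.
have PBC : P *m (B y *m (C u *m bethe_vec I)) = sumdel (fun j J =>
    ((phi u * psi (t j) - phi (t j) * psi u) * mu u j J * alpha u J)
       *: (P *m B y *m bethe_vec J)) I.
  rewrite mulmxA PBy -scalemxAl -mulmxA (IHI uI uI0 uI2) mulmx_sumdel scale_sumdel.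
  by apply: eq_sumdel => j J _; rewrite -scalemxAr -scalemxAl !mulmxA !scalerA mulrC.
rewrite -!scalemxAr [C u *m _]mulmxA CBy mulmxBl -scalemxAl mulmxBl -!mulmxA mulmxBr.
rewrite -scalemxAr mulmxBr PAD PAD' PBC opprD addrACA -scalerBl -sumdel_sub.
rewrite [(u - y)^-1 *: (_ + _)]scalerDr scale_sumdel -addrA -sumdel_sub.
rewrite scalerDr scale_sumdel !scalerA.
(* The first summand has lost the head [i], the others an index [j] of the tail; each comparison is
   a rational identity. *)
congr (_ + _).
  by congr (_ *: _); rewrite alpha_delta /mu -/y; field; rewrite ?ui ?pi0 ?di0.
apply: eq_sumdel => j J pI; have [uJ uJ0 jI jJ iJ] := subJ _ _ pI.
rewrite -!scalemxAr [P *m (_ *m _)]mulmxA !scalerA -!scalerBl !scalerA -!scalerBl scalerA.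
congr (_ *: _).
have pJ0 := shift_prod_neq0 iJ; have dJ0 := delta_neq0 jJ; rewrite -/y in pJ0.
have tij0 := tiI _ jI; have xj := uI0 _ jI; rewrite -/y in tij0.
have tji : t j - y + 1 != 0.
  by apply: t_shift; apply: contraNneq iI => <-.
have -> : shift_prod y I = (t j - y + 1) * shift_prod y J.
  by rewrite /shift_prod -(perm_big _ pI) big_cons.
have -> : mu u j (i :: J) = ((u - t j) * ((y - t j) * delta (t j) J))^-1.
  by rewrite /mu /delta big_cons.
have -> : alpha u I = (u - t j - 1) / (u - t j) * alpha u J.
  by rewrite /alpha -(perm_big _ pI) big_cons.
have -> : alpha u (i :: J) = (u - y - 1) / (u - y) * alpha u J.
  by rewrite /alpha big_cons.
by rewrite /mu; field; rewrite ?ui ?pJ0 ?dJ0 ?tij0 ?xj ?tji.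
Qed.
End Annihilated.
End OffShell.

(** * Coefficients of the Berezinian *)

Section TauSeriesTheory.
Variables (F : fieldType) (R : pzRingType).
Implicit Types (a d : F -> R) (H : tser F R).

Lemma ts_geomS d m x : ts_geom d m.+1 x = ts_geom d m x * d (x - m%:R).
Proof. by rewrite /ts_geom big_ord_recr. Qed.

Lemma ts_geomSl d m x : ts_geom d m.+1 x = d x * ts_geom d m (x - 1).
Proof.
rewrite /ts_geom big_ord_recl subr0; congr (_ * _); apply: eq_bigr => j _.
by congr (d _); rewrite lift0 -natr1; ring.
Qed.

Lemma ts_mul_tau0 a H x : ts_mul (ts_tau a) H 0 x = 0.
Proof. by rewrite /ts_mul big_ord_recl big_ord0 mul0r addr0. Qed.

Lemma ts_mul_tauS a H m x : ts_mul (ts_tau a) H m.+1 x = a x * H m (x - 1).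
Proof.
rewrite /ts_mul 2!big_ord_recl big1 => [|p _]; last by rewrite mul0r.
by rewrite mul0r add0r addr0 /ts_tau /= /bump /= subSS subn0.
Qed.

Lemma ts_tau_mulS a H m x : ts_mul H (ts_tau a) m.+1 x = H m x * a (x - m%:R).
Proof.
rewrite /ts_mul 2!big_ord_recr big1 /= => [|p _].
  by rewrite add0r subnn /ts_tau /= subSn // subnn mulr0 addr0.
by rewrite /ts_tau subSn 1?ltnW // eqSS subn_eq0 leqNgt ltn_ord mulr0.
Qed.

(** Coefficient form of X (1 - d tau) = H for X = H (1 - d tau)^{-1}. *)
Lemma ts_mul_geomS H d m x :
  ts_mul H (ts_geom d) m.+1 x = ts_mul H (ts_geom d) m x * d (x - m%:R) + H m.+1 x.
Proof.
rewrite /ts_mul big_ord_recr /= subnn {2}/ts_geom big_ord0 mulr1; congr (_ + _).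
rewrite mulr_suml; apply: eq_bigr => p _.
have le_pm : (p <= m)%N by rewrite -ltnS.
rewrite subSn // ts_geomS mulrA; congr (_ * d _).
by rewrite -addrA -opprD -natrD subnKC.
Qed.

(** From (1 - a tau)(1 - d tau)^{-1} = 1 + (d - a) tau (1 - d tau)^{-1}. *)
Lemma ts_mul_one_sub_geom a d m x :
  ts_mul (ts_sub (@ts_one F R) (ts_tau a)) (ts_geom d) m.+1 x
  = (d x - a x) * ts_geom d m (x - 1).
Proof.
rewrite /ts_mul 2!big_ord_recl big1 => [|p _]; last first.
  by rewrite /ts_sub /ts_one /ts_tau subrr mul0r.
rewrite addr0 /ts_sub /ts_one /ts_tau /= subr0 mul1r sub0r subr0 subSS.
by rewrite ts_geomSl /bump addn0 subn0 mulrBl mulNr.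
Qed.

End TauSeriesTheory.

(** * Recursions for the coefficients of tau^m *)

Section Fusion.
Variables (F : fieldType) (R : pzRingType) (a b c d : F -> R).
Hypothesis bb : forall x, b (x + 1) * b x = 0.
Hypothesis ab : forall x, a (x + 1) * b x = b (x + 1) * a x.
Hypothesis db : forall x, d (x + 1) * b x = b (x + 1) * d x.
Hypothesis cb : forall x, c (x + 1) * b x
  = a (x + 1) * d x - d (x + 1) * a x - b (x + 1) * c x.

Definition berezinian : tser F R :=
  ts_mul (ts_add (ts_sub (@ts_one F R) (ts_tau a))
                 (ts_mul (ts_mul (ts_tau b) (ts_geom d)) (ts_tau c)))
         (ts_geom d).

(** As b moves left past each d, its argument rises by one and that of d drops by one. *)
Lemma geom_b m x : ts_geom d m (x + 1) * b (x + 1 - m%:R) = b (x + 1) * ts_geom d m x.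
Proof.
elim: m x => [|m IHm] x; first by rewrite /ts_geom !big_ord0 subr0 mul1r mulr1.
rewrite ts_geomS (_ : x + 1 - m%:R = x + 1 - m.+1%:R + 1); last by rewrite -natr1; ring.
rewrite -mulrA db (_ : x + 1 - m.+1%:R + 1 = x + 1 - m%:R); last by rewrite -natr1; ring.
rewrite mulrA IHm ts_geomS -mulrA (_ : x + 1 - m.+1%:R = x - m%:R) //.
by rewrite -natr1; ring.
Qed.

Lemma berezinian0 x : berezinian 0 x = 1.
Proof.
rewrite /berezinian /ts_mul big_ord_recl big_ord0 addr0 /ts_geom big_ord0 mulr1.
by rewrite /ts_add /ts_sub /ts_one /ts_tau /= subr0 -/(ts_mul _ _) big_ord_recl
  big_ord0 mulr0 !addr0.
Qed.

Lemma berezinian1 x : berezinian 1 x = d x - a x.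
Proof.
rewrite /berezinian ts_mul_geomS -/berezinian berezinian0 subr0 mul1r.
rewrite /ts_add /ts_sub ts_tau_mulS.
by rewrite ts_mul_tau0 mul0r addr0 /ts_one /ts_tau /= sub0r.
Qed.

Lemma berezinianSS m x : berezinian m.+2 x = berezinian m.+1 x * d (x - m.+1%:R)
  + ts_geom d m x * b (x - m%:R) * c (x - m.+1%:R).
Proof.
rewrite {1}/berezinian ts_mul_geomS -/berezinian; congr (_ + _).
rewrite /ts_add /ts_sub ts_tau_mulS ts_mul_tauS /ts_one /ts_tau /= subrr add0r.
(* The numerator contributes b(x) d(x-1) ... d(x-m) c(x-m-1); b is moved next to c, so that c
   matters only modulo a kernel. *)
by have := geom_b m (x - 1); rewrite subrK => ->.
Qed.

(** In the inductive step [cb] replaces c b by a d - d a - b c. The last term dies by [bb], and a d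
    cancels against the part of the previous coefficient times d. *)
Lemma berezinian_mul_b m x : berezinian m.+1 x * b (x - m.+1%:R) =
  ts_geom d m x * b (x - m%:R) * (d (x - m.+1%:R) - a (x - m.+1%:R)).
Proof.
elim: m => [|m IHm].
  rewrite berezinian1 /ts_geom big_ord0 mul1r subr0 -{1 2 4}(subrK 1 x).
  by rewrite mulrBl mulrBr ab db.
rewrite berezinianSS; set u := x - m.+1%:R in IHm *.
have -> : x - m.+2%:R = u - 1 by rewrite /u -[m.+2%:R]natr1; ring.
have -> : x - m%:R = u + 1 by rewrite /u -[m.+1%:R]natr1; ring.
have {}IHm : berezinian m.+1 x * b u = ts_geom d m x * b (u + 1) * (d u - a u).
  by rewrite IHm /u; congr (_ * b _ * _); rewrite -[m.+1%:R]natr1; ring.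
have cbu : c u * b (u - 1) = a u * d (u - 1) - d u * a (u - 1) - b u * c (u - 1).
  by have := cb (u - 1); rewrite subrK.
have dbu : d u * b (u - 1) = b u * d (u - 1) by have := db (u - 1); rewrite subrK.
rewrite mulrDl -(mulrA _ (d u)) dbu (mulrA (berezinian _ _)) IHm.
rewrite -(mulrA _ (c u)) cbu ts_geomS.
have -> : x - m%:R = u + 1 by rewrite /u -[m.+1%:R]natr1; ring.
rewrite -(mulrA _ (d (u + 1))) db mulrA; set g := ts_geom d m x * b (u + 1).
have gb : g * b u = 0 by rewrite /g -mulrA bb mulr0.
have -> : g * (d u - a u) * d (u - 1) = g * d u * d (u - 1) - g * a u * d (u - 1).
  by rewrite mulrBr mulrBl.
rewrite !mulrBr !mulrA gb mul0r subr0.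
by rewrite addrA subrK.
Qed.
End Fusion.

(** * From the recursions to eigenvectors *)

Section Eigenvector.
Variables (F : fieldType) (N : nat) (a b c d : F -> 'M[F]_N).
Hypothesis bb : forall x, b (x + 1) * b x = 0.
Hypothesis ab : forall x, a (x + 1) * b x = b (x + 1) * a x.
Hypothesis db : forall x, d (x + 1) * b x = b (x + 1) * d x.
Hypothesis cb : forall x, c (x + 1) * b x
  = a (x + 1) * d x - d (x + 1) * a x - b (x + 1) * c x.
Variables (T : eqType) (I : seq T) (v : 'cV[F]_N) (w : T -> seq T -> 'cV[F]_N).
Variables (eva evd : F -> F) (kap eps : F -> T -> seq T -> F).

Let mulmxrA (M M' : 'M[F]_N) (p : 'cV[F]_N) : (M * M') *m p = M *m (M' *m p).
Proof. by rewrite [RHS]mulmxA. Qed.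

(** Here [kap] gives the unwanted coefficients of d on [v], and [eps] the eigenvalues of d - a on
    the smaller vectors modulo the kernel of b(u + 1). By [berezinian_mul_b] the unwanted terms
    acquire the factor [eps], and the condition on c cancels them. *)
Lemma berezinian_eigenvector m x :
  (forall u, u = x \/ (exists2 j, (j < m)%N & u = x - j.+1%:R) ->
    (d u - a u) *m v = (evd u - eva u) *: v) ->
  (forall j, (j < m)%N -> let u := x - j.+1%:R in
    [/\ d u *m v = evd u *: v + sumdel (fun i J => kap u i J *: (b u *m w i J)) I,
        b (u + 1) *m (c u *m v)
          = - sumdel (fun i J => (kap u i J * eps u i J) *: (b (u + 1) *m w i J)) I
      & forall i J, perm_eq (i :: J) I ->
         b (u + 1) *m ((d u - a u) *m w i J) = eps u i J *: (b (u + 1) *m w i J)]) ->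
  berezinian a b c d m x *m v =
  ts_mul (ts_sub (@ts_one F F) (ts_tau eva)) (ts_geom evd) m x *: v.
Proof.
case: m => [|m] ev_da off.
  rewrite berezinian0 mul1mx /ts_mul big_ord_recl big_ord0 /ts_geom big_ord0.
  by rewrite /ts_sub /ts_one /ts_tau subr0 mulr1 addr0 scale1r.
(* From the first coefficient on, the eigenvalue is a difference at x times a geometric product,
   which gains one factor per step. *)
rewrite ts_mul_one_sub_geom.
elim: m ev_da off => [|m IHm] ev_da off.
  by rewrite berezinian1 ev_da; [rewrite /ts_geom big_ord0 mulr1|left].
rewrite berezinianSS //; set u := x - m.+1%:R.
have [dv cv wv] := off m (ltnW (ltnSn _)); rewrite -/u in dv cv wv.
have xm : x - m%:R = u + 1 by rewrite /u -[m.+1%:R]natr1; ring.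
have IH : berezinian a b c d m.+1 x *m v =
    ((evd x - eva x) * ts_geom evd m (x - 1)) *: v.
  apply: IHm => [u' [->|[j jm ->]]|j jm]; [by apply: ev_da; left| |exact: off (ltnW jm)].
  by apply: ev_da; right; exists j => //; apply: ltnW.
rewrite xm mulmxDl 3!mulmxrA dv mulmxDr -scalemxAr IH scalerA cv mulmxN !mulmx_sumdel.
rewrite -addrA -sumdel_sub (@eq_sumdel _ _ _ (fun _ _ => 0)) ?sumdel0.
  rewrite addr0 ts_geomS mulrC -mulrA; congr ((_ * (_ * evd _)) *: _).
  by rewrite /u -natr1; ring.
move=> i J pI; rewrite -!scalemxAr -[_ *m (b u *m _)]mulmxrA berezinian_mul_b // -/u xm.
by rewrite !mulmxrA wv // -!scalemxAr scalerA subrr.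
Qed.
End Eigenvector.

(** * Divisibility of the Bethe vector *)

Section Substitution.
Variables (F : fieldType) (l : nat).
Notation S := {mpoly F[l]}.

(** With [q] equal to ['X_j + 1], this tests divisibility by the factor ['X_j - 'X_i + 1] of the
    denominator. *)
Definition subX (i : 'I_l) (q : S) : S -> S :=
  mmap (@mpolyC l F) (fun j => if j == i then q else 'X_j).
HB.instance Definition _ i q := GRing.RMorphism.copy (subX i q)
  (mmap (@mpolyC l F) (fun j => if j == i then q else 'X_j)).

Lemma subXC i q c : subX i q c%:MP = c%:MP.
Proof. by rewrite /subX mmapC. Qed.

Lemma subX_id i q : subX i q 'X_i = q.
Proof. by rewrite /subX mmapX mmap1U eqxx. Qed.

Lemma subX_neq i q j : j != i -> subX i q 'X_j = 'X_j.
Proof. by move=> /negbTE ji; rewrite /subX mmapX mmap1U ji. Qed.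

(** Factor theorem: the congruence modulo ['X_i - q] holds for constants and variables, and passes
    to products and sums. *)
Lemma subX_congr i q p : exists r, p - subX i q p = r * ('X_i - q).
Proof.
pose E p := exists r, p - subX i q p = r * ('X_i - q).
have EM p1 p2 : E p1 -> E p2 -> E (p1 * p2).
  move=> [r1 e1] [r2 e2]; exists (r1 * p2 + subX i q p1 * r2).
  rewrite rmorphM mulrDl -[subX i q p1 * r2 * _]mulrA -e2 mulrAC -e1.
  by rewrite mulrBl mulrBr addrA subrK.
have EC c : E c%:MP by exists 0; rewrite subXC subrr mul0r.
have EX j : E 'X_j.
  have [->|ji] := eqVneq j i; first by exists 1; rewrite subX_id mul1r.
  by exists 0; rewrite subX_neq // subrr mul0r.
have EP (I : Type) (s : seq I) (G : I -> S) : (forall j, E (G j)) -> E (\prod_(j <- s) G j).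
  by move=> EG; elim/big_ind: _ => //; rewrite -mpolyC1; apply: EC.
elim/mpolyind: p => [|c m p _ _ [r2 e2]]; first by rewrite -mpolyC0; apply: EC.
have [r1 e1] : E (c *: 'X_[m]).
  rewrite -mul_mpolyC mpolyXE_id; apply: (EM _ _ (EC _)); apply: EP => j.
  by elim: (m j) => [|n IHn]; rewrite ?expr0 -?mpolyC1 // exprS; apply: EM.
by exists (r1 + r2); rewrite rmorphD opprD addrACA e1 e2 mulrDl.
Qed.

Lemma dvd_subX0 i q p : subX i q p = 0 -> exists r, p = r * ('X_i - q).
Proof. by move=> p0; have [r] := subX_congr i q p; rewrite p0 subr0; exists r. Qed.

Lemma mpolyX_sub_neq0 (i j : 'I_l) (c : F) : i != j -> 'X_i - 'X_j + c%:MP != 0 :> S.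
Proof.
(* At this point the polynomial takes the value 1. *)
move=> ij; apply/negP => /eqP /(congr1 (meval (fun s => if s == i then 1 - c else 0))).
rewrite mevalD mevalB !mevalXU mevalC meval0 eqxx eq_sym (negbTE ij) subr0 subrK.
by apply/eqP; rewrite oner_eq0.
Qed.

Lemma mpolyX_cst_neq0 (i : 'I_l) (c : F) : c%:MP - 'X_i != 0 :> S.
Proof.
apply/negP => /eqP /(congr1 (meval (fun s => c - 1))).
rewrite mevalB mevalXU mevalC meval0 opprB addrC subrK.
by apply/eqP; rewrite oner_eq0.
Qed.

(* The factors are prime and pairwise coprime: each of them spans the kernel of
   a substitution which kills none of the others. *)
Lemma dvd_prod_shift (i : 'I_l) (J : seq 'I_l) (p : S) :
  uniq J -> i \notin J -> (forall j, j \in J -> subX i ('X_j + 1) p = 0) ->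
  exists r, p = (\prod_(j <- J) ('X_j - 'X_i + 1)) * r.
Proof.
elim: J => [|j J IHJ] /=; first by exists p; rewrite big_nil mul1r.
move=> /andP[jJ uJ]; rewrite inE negb_or => /andP[ij iJ] p0.
have [|r pr] := IHJ uJ iJ; first by move=> j' j'J; apply: p0; rewrite inE j'J orbT.
have /dvd_subX0[r' rr'] : subX i ('X_j + 1) r = 0.
  have /eqP := p0 j (mem_head _ _); rewrite pr rmorphM mulf_eq0 => /orP[|/eqP //].
  rewrite rmorph_prod prodf_seq_eq0 => /hasP[j' j'J] /=.
  rewrite rmorphD rmorphB rmorph1 /= subX_id subX_neq; last by apply: contraNneq iJ => <-.
  rewrite opprD addrA subrK -[_ - _]addr0 -mpolyC0.
  by rewrite (negbTE (mpolyX_sub_neq0 _ _)) //; apply: contraNneq jJ => <-.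
(* The sign is that of ['X_i - ('X_j + 1)] against ['X_j - 'X_i + 1]. *)
exists (- r'); rewrite pr rr' big_cons; ring.
Qed.

End Substitution.

Section BetheDivisibility.
Variables (F : fieldType) (l k : nat) (l1 l2 z : 'I_k -> F).
Hypothesis two_neq0 : 2%:R != 0 :> F.
Notation S := {mpoly F[l]}.
Notation BS := (Tn (fun s => (l1 s)%:MP) (fun s => (l2 s)%:MP) (fun s => (z s)%:MP)
                   false true : S -> 'M[S]_#|tbasis k|).

Fixpoint bethe_seq (I : seq 'I_l) : 'cV[S]_#|tbasis k| :=
  if I is i :: I' then BS 'X_i *m bethe_seq I' else @vacuum k S.

Fixpoint den_seq (I : seq 'I_l) : S :=
  if I is i :: I' then (\prod_(j <- I') ('X_j - 'X_i + 1)) * den_seq I' else 1.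

Lemma two_neq0_mpoly : 2%:R != 0 :> S.
Proof. by rewrite -mpolyC_nat mpolyC_eq0. Qed.

(** If [j] leads, this is exclusion; otherwise the operator moves past the leading one, the
    coefficient being the nonzero polynomial X_j - X_i + 2. *)
Lemma BS_shift_bethe_seq j I : j \in I -> BS ('X_j + 1) *m bethe_seq I = 0.
Proof.
have BB := Tn_BB (fun s => (l1 s)%:MP) (fun s => (l2 s)%:MP) (fun s => (z s)%:MP : S).
elim: I => // i I IHI; rewrite inE [bethe_seq _]/=.
have [-> _|ji /= jI] := eqVneq j i.
  by rewrite mulmxA (BB_shift two_neq0_mpoly BB) mul0mx.
apply: (BB_annihilate BB _ (IHI jI)).
rewrite (_ : _ + 1 = 'X_j - 'X_i + (2%:R)%:MP); last by rewrite mpolyC_nat; ring.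
exact: mpolyX_sub_neq0.
Qed.

Lemma den_seq_neq0 I : uniq I -> den_seq I != 0.
Proof.
elim: I => [|i I IHI] /=; first by rewrite oner_eq0.
move=> /andP[iI uI]; rewrite mulf_neq0 ?IHI // prodf_seq_neq0.
apply/allP => j jI /=; rewrite -mpolyC1 mpolyX_sub_neq0 //.
by apply: contraNneq iI => <-.
Qed.

Lemma subX_den_seq i q I : i \notin I -> subX i q (den_seq I) = den_seq I.
Proof.
elim: I => [|j I IHI] /=; first by rewrite rmorph1.
rewrite inE negb_or => /andP[ij iI]; rewrite rmorphM /= IHI // rmorph_prod.
congr (_ * _); apply: eq_big_seq => j' j'I.
rewrite rmorphD rmorphB rmorph1 /= !subX_neq //; first by rewrite eq_sym.
by apply: contraNneq iI => <-.
Qed.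

Lemma map_subX_BS i q x : map_mx (subX i q) (BS x) = BS (subX i q x).
Proof. by apply: map_Tn => s; rewrite /= subXC. Qed.

Lemma subX_bethe_seq i q I : i \notin I -> map_mx (subX i q) (bethe_seq I) = bethe_seq I.
Proof.
elim: I => [|j I IHI] /=; first by rewrite map_vacuum.
rewrite inE negb_or => /andP[ij iI]; rewrite map_mxM /= IHI // map_subX_BS.
by rewrite subX_neq // eq_sym.
Qed.

(** The tail is divided first. Substituting X_j + 1 for X_i leaves the tail and its denominator
    unchanged, so [BS_shift_bethe_seq] makes the remaining vector vanish for each [j] in the
    tail. *)
Lemma den_dvd_bethe_seq I : uniq I -> exists Q, bethe_seq I = den_seq I *: Q.
Proof.
elim: I => [|i I IHI] /=; first by exists (@vacuum k S); rewrite scale1r.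
move=> /andP[iI uI]; have [Q eQ] := IHI uI.
have dvd_a (a : 'I_#|tbasis k|) : exists r,
    (BS 'X_i *m Q) a 0 = (\prod_(j <- I) ('X_j - 'X_i + 1)) * r.
  apply: dvd_prod_shift => // j jI.
  have : map_mx (subX i ('X_j + 1)) (BS 'X_i *m Q) = 0.
    rewrite map_mxM map_subX_BS subX_id.
    have := BS_shift_bethe_seq jI; rewrite -(subX_bethe_seq ('X_j + 1) iI) eQ.
    rewrite map_mxZ /= subX_den_seq //.
    move: (BS _) (map_mx _ Q) (den_seq_neq0 uI) => M v d0 /eqP.
    by rewrite -scalemxAr scalemx_eq0 (negbTE d0) => /eqP.
  by move/matrixP/(_ a 0); rewrite !mxE.
have [r er] := fin_all_exists dvd_a.
exists (\col_a r a); rewrite eQ; move: (BS _) er => M er.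
rewrite -scalemxAr mulrC -scalerA; congr (_ *: _).
by apply/matrixP => a j; rewrite ord1 er !mxE.
Qed.

(** The Boolean implication lets [xchoose] produce a quotient defined on every list. *)
Fact bethe_quot_subproof I : exists Q, uniq I ==> (bethe_seq I == den_seq I *: Q).
Proof.
have [uI|nuI] := boolP (uniq I); last by exists 0.
by have [Q ->] := den_dvd_bethe_seq uI; exists Q; rewrite eqxx.
Qed.

Definition bethe_quot I : 'cV[S]_#|tbasis k| := xchoose (bethe_quot_subproof I).

Lemma bethe_quotE I : uniq I -> bethe_seq I = den_seq I *: bethe_quot I.
Proof. by move=> uI; have /implyP/(_ uI)/eqP := xchooseP (bethe_quot_subproof I). Qed.

End BetheDivisibility.

(** * Specialization at distinct points *)

Section Specialization.
Variables (F : fieldType) (l : nat) (t : 'I_l -> F).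
Notation S := {mpoly F[l]}.
Notation K := {fraction S}.
Notation frac := (@tofrac S).

(* [spec a b]: the rational function [a] is regular at [t], with value [b]. *)
Definition spec (a : K) (b : F) : Prop :=
  exists p q : S, [/\ q.@[t] != 0, a = frac p / frac q & b = p.@[t] / q.@[t]].

Lemma frac_neq0 (q : S) : q.@[t] != 0 -> frac q != 0.
Proof. by apply: contra_neq => /eqP; rewrite tofrac_eq0 => /eqP->; rewrite meval0. Qed.

(** Cross-multiplying gives a polynomial identity, which can be evaluated. Thus identities over the
    function field are read at [t]. *)
Lemma spec_uniq a b b' : spec a b -> spec a b' -> b = b'.
Proof.
move=> [p [q [q0 -> ->]]] [p' [q' [q'0 e ->]]].
have /eqP := e; rewrite eqr_div ?frac_neq0 // -!tofracM tofrac_eq.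
move=> /eqP /(congr1 (meval t)).
by rewrite !mevalM => e'; apply/eqP; rewrite eqr_div // e'.
Qed.

Lemma spec_frac p : spec (frac p) p.@[t].
Proof. by exists p, 1; rewrite meval1 tofrac1 !divr1 oner_neq0. Qed.

Lemma specD a b a' b' : spec a b -> spec a' b' -> spec (a + a') (b + b').
Proof.
move=> [p [q [q0 -> ->]]] [p' [q' [q'0 -> ->]]].
exists (p * q' + p' * q), (q * q'); rewrite tofracD !tofracM mevalD !mevalM.
by rewrite !addf_div ?frac_neq0 // mulf_neq0.
Qed.

Lemma specM a b a' b' : spec a b -> spec a' b' -> spec (a * a') (b * b').
Proof.
move=> [p [q [q0 -> ->]]] [p' [q' [q'0 -> ->]]].
by exists (p * p'), (q * q'); rewrite !tofracM !mevalM !mulf_div mulf_neq0.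
Qed.

Lemma spec0 : spec 0 0.
Proof. by rewrite -tofrac0 -(meval0 t); apply: spec_frac. Qed.

Lemma spec1 : spec 1 1.
Proof. by rewrite -tofrac1 -(meval1 t); apply: spec_frac. Qed.

Lemma specN a b : spec a b -> spec (- a) (- b).
Proof.
move=> sab; rewrite -mulN1r -[- b]mulN1r; apply: specM => //.
by rewrite -tofrac1 -tofracN -(meval1 t) -mevalN; apply: spec_frac.
Qed.

Lemma specB a b a' b' : spec a b -> spec a' b' -> spec (a - a') (b - b').
Proof. by move=> sab sab'; apply: specD => //; apply: specN. Qed.

Lemma specV a b : spec a b -> b != 0 -> spec a^-1 b^-1.
Proof.
move=> [p [q [q0 -> ->]]] b0; exists q, p; rewrite !invf_div; split=> //.
by apply: contraNneq b0 => ->; rewrite mul0r.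
Qed.

Lemma spec_sum (I : Type) (s : seq I) (f : I -> K) (g : I -> F) :
  (forall i, spec (f i) (g i)) -> spec (\sum_(i <- s) f i) (\sum_(i <- s) g i).
Proof.
move=> fg; elim: s => [|i s IHs]; first by rewrite !big_nil; apply: spec0.
by rewrite !big_cons; apply: specD.
Qed.

Lemma spec_prod (I : eqType) (s : seq I) (f : I -> K) (g : I -> F) :
  (forall i, i \in s -> spec (f i) (g i)) -> spec (\prod_(i <- s) f i) (\prod_(i <- s) g i).
Proof.
elim: s => [|i s IHs] fg; first by rewrite !big_nil; apply: spec1.
rewrite !big_cons; apply: specM; first by apply: fg; rewrite mem_head.
by apply: IHs => j js; apply: fg; rewrite inE js orbT.
Qed.

Definition specmx m n (M : 'M[K]_(m, n)) (M' : 'M[F]_(m, n)) : Prop :=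
  forall i j, spec (M i j) (M' i j).

Lemma specmx_uniq m n (M : 'M[K]_(m, n)) M' M'' :
  specmx M M' -> specmx M M'' -> M' = M''.
Proof. by move=> s' s''; apply/matrixP => i j; apply: (spec_uniq (s' i j)). Qed.

Lemma specmx_map m n (M : 'M[S]_(m, n)) :
  specmx (map_mx frac M) (map_mx (meval t) M).
Proof. by move=> i j; rewrite !mxE; apply: spec_frac. Qed.

Lemma specmxD m n (M M1 : 'M[K]_(m, n)) M' M1' :
  specmx M M' -> specmx M1 M1' -> specmx (M + M1) (M' + M1').
Proof. by move=> s s1 i j; rewrite !mxE; apply: specD. Qed.

Lemma specmxZ m n (M : 'M[K]_(m, n)) M' a b :
  spec a b -> specmx M M' -> specmx (a *: M) (b *: M').
Proof. by move=> s s1 i j; rewrite !mxE; apply: specM. Qed.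

Lemma specmxM m n p (M : 'M[K]_(m, n)) M' (M1 : 'M[K]_(n, p)) M1' :
  specmx M M' -> specmx M1 M1' -> specmx (M *m M1) (M' *m M1').
Proof. by move=> s s1 i j; rewrite !mxE; apply: spec_sum => h; apply: specM. Qed.

Lemma specmx_sumdel (T : eqType) m n (f : T -> seq T -> 'M[K]_(m, n)) g I :
  (forall i J, perm_eq (i :: J) I -> specmx (f i J) (g i J)) ->
  specmx (sumdel f I) (sumdel g I).
Proof.
elim: I f g => [|i I IHI] f g fg /=.
  by move=> i j; rewrite !mxE; apply: spec0.
apply: specmxD; first exact: fg.
apply: IHI => j J pI; apply: fg.
rewrite -(perm_cons i) in pI; apply: perm_trans pI.
by apply/permP => p /=; rewrite addnCA.
Qed.

Hypothesis t_inj : injective t.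
Notation tK := (fun i : 'I_l => frac 'X_i).
Notation cK := (fun c : F => frac c%:MP).

Lemma spec_cst c : spec (cK c) c.
Proof. by have := spec_frac c%:MP; rewrite mevalC. Qed.

Lemma spec_var i : spec (tK i) (t i).
Proof. by have := spec_frac 'X_i; rewrite mevalXU. Qed.

Lemma spec_mu u i I : u != t i -> i \notin I ->
  spec (mu tK (cK u) i I) (mu t u i I).
Proof.
move=> ui iI; apply: specV; last first.
  rewrite mulf_neq0 ?subr_eq0 // /delta prodf_seq_neq0; apply/allP => j jI /=.
  by rewrite subr_eq0 (inj_eq t_inj); apply: contraNneq iI => <-.
apply: specM; first exact: specB (spec_cst _) (spec_var _).
by apply: spec_prod => j _; apply: specB (spec_var _) (spec_var _).
Qed.

Lemma spec_alpha u I : (forall i, i \in I -> u != t i) ->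
  spec (alpha tK (cK u) I) (alpha t u I).
Proof.
move=> uI; apply: spec_prod => j jI; apply: specM.
  apply: specB spec1; exact: specB (spec_cst _) (spec_var _).
by apply: specV; [exact: specB (spec_cst _) (spec_var _)|rewrite subr_eq0 uI].
Qed.

Hypothesis two_neq0 : 2%:R != 0 :> F.
Variables (k : nat) (l1 l2 z : 'I_k -> F).
Notation TF := (Tn l1 l2 z).
Notation TK := (Tn (cK \o l1) (cK \o l2) (cK \o z)).

Lemma spec_Tn i j u : specmx (TK i j (cK u)) (TF i j u).
Proof.
have -> : TK i j (cK u) = map_mx frac (Tn (fun s => (l1 s)%:MP) (fun s => (l2 s)%:MP)
    (fun s => (z s)%:MP) i j u%:MP) by symmetry; apply: map_Tn.
have -> : TF i j u = map_mx (meval t) (Tn (fun s => (l1 s)%:MP) (fun s => (l2 s)%:MP)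
    (fun s => (z s)%:MP) i j u%:MP).
  symmetry; rewrite -[u in RHS](mevalC t u).
  by apply: map_Tn => s; rewrite /= mevalC.
exact: specmx_map.
Qed.

(** The extension by continuity of the normalized Bethe vector: the division is carried out before
    evaluation, so some t_j - t_i + 1 may vanish. *)
Definition bethe_at (I : seq 'I_l) : 'cV[F]_#|tbasis k| :=
  map_mx (meval t) (bethe_quot l1 l2 z two_neq0 I).

Lemma bethe_vec_frac I : uniq I ->
  bethe_vec tK (TK false true) (@vacuum k K) I =
  map_mx frac (bethe_quot l1 l2 z two_neq0 I).
Proof.
move=> uI.
have vecI : frac (den_seq F I) *: bethe_vec tK (TK false true) (@vacuum k K) I =
    map_mx frac (bethe_seq l1 l2 z I).
  elim: I uI => [|i I IHI] /=; first by rewrite rmorph1 scale1r map_vacuum.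
  move=> /andP[iI uI]; rewrite map_mxM -(IHI uI).
  have -> : map_mx frac (Tn (fun s => (l1 s)%:MP) (fun s => (l2 s)%:MP)
     (fun s => (z s)%:MP) false true 'X_i) = TK false true (tK i) by apply: map_Tn.
  have -> : shift_prod tK (tK i) I = frac (\prod_(j <- I) ('X_j - 'X_i + 1)).
    by rewrite rmorph_prod; apply: eq_bigr => j _; rewrite /= tofracD tofracB tofrac1.
  rewrite tofracM -scalemxAr scalerA; congr (_ *: _).
  rewrite mulrAC mulfV ?mul1r // tofrac_eq0 prodf_seq_neq0; apply/allP => j jI /=.
  by rewrite -mpolyC1 mpolyX_sub_neq0 //; apply: contraNneq iI => <-.
have d0 : frac (den_seq F I) != 0 by rewrite tofrac_eq0 den_seq_neq0.
apply: (scalerI d0); rewrite vecI (bethe_quotE _ _ _ two_neq0 uI) map_mxZ //.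
Qed.

Lemma spec_bethe_vec I : uniq I ->
  specmx (bethe_vec tK (TK false true) (@vacuum k K) I) (bethe_at I).
Proof. by move=> uI; rewrite bethe_vec_frac //; apply: specmx_map. Qed.

Lemma spec_phi u : spec (phi (cK \o l1) (cK \o z) (cK u)) (phi l1 z u).
Proof.
by apply: spec_prod => s _; apply: specD; [apply: specB|]; apply: spec_cst.
Qed.

Lemma spec_psi u : spec (psi (cK \o l2) (cK \o z) (cK u)) (psi l2 z u).
Proof.
by apply: spec_prod => s _; apply: specB; [apply: specB|]; apply: spec_cst.
Qed.

Lemma spec_phi_var i : spec (phi (cK \o l1) (cK \o z) (tK i)) (phi l1 z (t i)).
Proof.
apply: spec_prod => s _; apply: specD; [apply: specB|]; [|exact: spec_cst..].
exact: spec_var.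
Qed.

Lemma spec_psi_var i : spec (psi (cK \o l2) (cK \o z) (tK i)) (psi l2 z (t i)).
Proof.
apply: spec_prod => s _; apply: specB; [apply: specB|]; [|exact: spec_cst..].
exact: spec_var.
Qed.

Lemma tK_sub_neq0 i j c : i != j -> tK i - tK j + cK c != 0.
Proof. by move=> ij; rewrite -tofracB -tofracD tofrac_eq0 mpolyX_sub_neq0. Qed.

Lemma cK_sub_tK_neq0 c i : cK c - tK i != 0.
Proof. by rewrite -tofracB tofrac_eq0 mpolyX_cst_neq0. Qed.

Lemma two_neq0_frac : 2%:R != 0 :> K.
Proof. by rewrite -(rmorph_nat frac) tofrac_eq0 -mpolyC_nat mpolyC_eq0. Qed.

Lemma cKD x y : cK (x + y) = cK x + cK y.
Proof. by rewrite /= mpolyCD tofracD. Qed.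

Lemma cK1 : cK 1 = 1.
Proof. by rewrite /= mpolyC1 tofrac1. Qed.

Let t_neqK i j : i != j -> tK i - tK j != 0.
Proof. by move=> ij; rewrite -[_ - _]addr0 -tofrac0 -mpolyC0 tK_sub_neq0. Qed.

Let t_shiftK i j : i != j -> tK i - tK j + 1 != 0.
Proof. by move=> ij; rewrite -cK1 tK_sub_neq0. Qed.

(** Over the function field the nonvanishing conditions are automatic. All terms of the generic
    formula are regular at distinct points different from [u], so both sides specialize. *)
Lemma bethe_at_exchange (XK : K -> 'M_#|tbasis k|) (XF : F -> 'M_#|tbasis k|) fK fF u I :
  exchange (TK false true) XK -> (forall x, XK x *m @vacuum k K = fK x *: @vacuum k K) ->
  specmx (XK (cK u)) (XF u) -> spec (fK (cK u)) (fF u) ->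
  (forall i, spec (fK (tK i)) (fF (t i))) ->
  uniq I -> (forall i, i \in I -> u != t i) ->
  XF u *m bethe_at I = (fF u * alpha t u I) *: bethe_at I
   + sumdel (fun j J => (fF (t j) * mu t u j J) *: (TF false true u *m bethe_at J)) I.
Proof.
move=> XB Xvac sX sf sft uI ut.
apply: (specmx_uniq (M := XK (cK u) *m bethe_vec tK (TK false true) (@vacuum k K) I)).
  by apply: specmxM sX (spec_bethe_vec uI).
rewrite (bethe_vec_exchange (Tn_BB _ _ _) t_neqK t_shiftK XB Xvac uI) => [|i _]; last first.
  exact: cK_sub_tK_neq0.
apply: specmxD.
  by apply: specmxZ (spec_bethe_vec uI); apply: specM sf (spec_alpha ut).
apply: specmx_sumdel => j J pI; have /andP[jJ uJ] : uniq (j :: J) by rewrite (perm_uniq pI).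
apply: specmxZ; last exact: specmxM (spec_Tn _ _ _) (spec_bethe_vec uJ).
apply: specM (sft j) (spec_mu _ jJ); apply: ut.
by rewrite -(perm_mem pI) mem_head.
Qed.

Lemma bethe_at_A u I : uniq I -> (forall i, i \in I -> u != t i) ->
  TF false false u *m bethe_at I = (phi l1 z u * alpha t u I) *: bethe_at I
   + sumdel (fun j J => (phi l1 z (t j) * mu t u j J) *:
        (TF false true u *m bethe_at J)) I.
Proof.
apply: (bethe_at_exchange (Tn_AB _ _ _) (Tn_A_vac _ _ _)).
- exact: spec_Tn.
- exact: spec_phi.
- exact: spec_phi_var.
Qed.

Lemma bethe_at_D u I : uniq I -> (forall i, i \in I -> u != t i) ->
  TF true true u *m bethe_at I = (psi l2 z u * alpha t u I) *: bethe_at I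
   + sumdel (fun j J => (psi l2 z (t j) * mu t u j J) *:
        (TF false true u *m bethe_at J)) I.
Proof.
apply: (bethe_at_exchange (Tn_DB _ _ _) (Tn_D_vac _ _ _)).
- exact: spec_Tn.
- exact: spec_psi.
- exact: spec_psi_var.
Qed.

Lemma bethe_at_C_mod u I : uniq I -> (forall i, i \in I -> u != t i) ->
  TF false true (u + 1) *m (TF true false u *m bethe_at I) =
  sumdel (fun j J => ((phi l1 z u * psi l2 z (t j) - phi l1 z (t j) * psi l2 z u)
      * mu t u j J * alpha t u J) *: (TF false true (u + 1) *m bethe_at J)) I.
Proof.
move=> uI ut.
apply: (specmx_uniq (M := TK false true (cK (u + 1)) *m (TK true false (cK u) *m
   bethe_vec tK (TK false true) (@vacuum k K) I))).
  by apply: specmxM (spec_Tn _ _ _) (specmxM (spec_Tn _ _ _) (spec_bethe_vec uI)).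
rewrite cKD cK1.
rewrite (bethe_vec_C_mod two_neq0_frac (Tn_BB _ _ _) (Tn_AB _ _ _) (Tn_DB _ _ _)
  (Tn_CB _ _ _)
  (Tn_A_vac _ _ _) (Tn_D_vac _ _ _) (Tn_C_vac _ _ _) t_neqK t_shiftK uI); first last.
(* This factor contains the variable ['X_i], hence is nonzero whatever the value of [t i]. *)
- move=> i _; rewrite [X in X != 0](_ : _ = cK (u + 2%:R) - tK i).
    exact: cK_sub_tK_neq0.
  by rewrite cKD /= mpolyC_nat rmorph_nat addrAC.
- by move=> i _; apply: cK_sub_tK_neq0.
rewrite -cK1 -cKD.
apply: specmx_sumdel => j J pI; have /andP[jJ uJ] : uniq (j :: J) by rewrite (perm_uniq pI).
apply: specmxZ; last exact: specmxM (spec_Tn _ _ _) (spec_bethe_vec uJ).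
apply: specM; [apply: specM|].
- by apply: specB; apply: specM;
    [apply: spec_phi|apply: spec_psi_var|apply: spec_phi_var|apply: spec_psi].
- by apply: spec_mu => //; apply: ut; rewrite -(perm_mem pI) mem_head.
- by apply: spec_alpha => i iJ; apply: ut; rewrite -(perm_mem pI) inE iJ orbT.
Qed.

Lemma Tn_B_shift x : TF false true (x + 1) *m TF false true x = 0.
Proof. exact: (BB_shift two_neq0 (Tn_BB l1 l2 z)). Qed.

Lemma bethe_at_exchange_mod X f u I :
  (X u *m bethe_at I = (f u * alpha t u I) *: bethe_at I
   + sumdel (fun j J => (f (t j) * mu t u j J) *: (TF false true u *m bethe_at J)) I) ->
  TF false true (u + 1) *m (X u *m bethe_at I)
  = (f u * alpha t u I) *: (TF false true (u + 1) *m bethe_at I).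
Proof.
move=> ->; rewrite mulmxDr -scalemxAr mulmx_sumdel.
rewrite (@eq_sumdel _ _ _ (fun _ _ => 0)) ?sumdel0 ?addr0 // => j J _.
by rewrite -scalemxAr mulmxA Tn_B_shift mul0mx scaler0.
Qed.
End Specialization.

(** * On-shell Bethe vectors *)

Lemma big_ord_enum l (R : Type) (idx : R) op (f : 'I_l -> R) :
  \big[op/idx]_(i < l) f i = \big[op/idx]_(i <- enum 'I_l) f i.
Proof. by rewrite enumT. Qed.

Section Numerators.
Variables (F : fieldType) (k l : nat) (l1 l2 b : 'I_k -> F).
Notation S := {mpoly F[l]}.

Lemma bethe_num_seq : bethe_num l l1 l2 b = bethe_seq l1 l2 b (enum 'I_l).
Proof.
rewrite /bethe_num big_ord_enum.
elim: (enum _) => [|i I IHI]; first by rewrite big_nil mul1mx.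
by rewrite big_cons [bethe_seq _ _ _ _]/= -IHI [RHS]mulmxA.
Qed.

(** In an increasing list the later entries are exactly the larger ones. *)
Lemma den_seq_sorted (I : seq 'I_l) : pairwise (fun i j : 'I_l => (i < j)%N) I ->
  den_seq F I = \prod_(i <- I) \prod_(j <- I | (i < j)%N) ('X_j - 'X_i + 1).
Proof.
elim: I => [|i I IHI] /=; first by rewrite big_nil.
move=> /andP[/allP iI pI]; rewrite big_cons big_cons ltnn (IHI pI).
congr (_ * _); last first.
  apply: eq_big_seq => j jI; rewrite big_cons ltnNge.
  by rewrite (ltnW (iI _ jI)).
rewrite [RHS]big_seq_cond [LHS]big_seq_cond; apply: eq_bigl => j.
by case: (boolP (j \in I)) => //= /iI ->.
Qed.

Lemma bethe_den_seq : bethe_den F l = den_seq F (enum 'I_l).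
Proof.
rewrite den_seq_sorted; last first.
  rewrite -sorted_pairwise; last by move=> ? ? ?; apply: ltn_trans.
  have := iota_ltn_sorted 0 l; rewrite -val_enum_ord sorted_map.
  by apply: sub_sorted.
rewrite /bethe_den big_enum /=; apply: eq_bigr => i _.
by rewrite big_enum_cond.
Qed.
End Numerators.

Section Normalized.
Variables (F : fieldType) (k : nat) (l1 l2 b : 'I_k -> F).
Notation h x := (\prod_(s < k) (x - b s))^-1.

Lemma Tmx_Tn i j x : Tmx l1 l2 b i j x = h x *: Tn l1 l2 b i j x.
Proof. by apply/matrixP => a c; rewrite !mxE mulrC. Qed.

Lemma zeta1_phi x : zeta1 l1 b x = phi l1 b x * h x.
Proof. by rewrite /zeta1 prodf_div. Qed.

Lemma zeta2_psi x : zeta2 l2 b x = psi l2 b x * h x.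
Proof. by rewrite /zeta2 prodf_div. Qed.

Lemma BAE_root l (t : 'I_l -> F) q1 q2 : BAE l1 l2 b q1 q2 t ->
  forall i, q1 * phi l1 b (t i) = q2 * psi l2 b (t i).
Proof.
move=> hB i; have : root (q1 *: phi_pol l1 b - q2 *: psi_pol l2 b) (t i).
  rewrite -dvdp_XsubCl; apply: dvdp_trans hB; rewrite (bigD1 i) //=.
  exact: dvdp_mulIl.
rewrite /root !hornerE /phi_pol /psi_pol !horner_prod subr_eq0 => /eqP.
rewrite (eq_bigr (fun s => t i - b s + l1 s)) => [->|s _].
  congr (_ * _); apply: eq_bigr => s _; rewrite !hornerE; ring.
by rewrite !hornerE; ring.
Qed.

End Normalized.

Lemma mulmx_scale2 (R : comPzRingType) n (c d : R) (M M' : 'M[R]_n) :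
  (c *: M) * (d *: M') = (c * d) *: (M *m M').
Proof. by rewrite -[LHS]/((c *: M) *m (d *: M')) -scalemxAl -scalemxAr scalerA. Qed.

Lemma alpha_ypol (F : fieldType) l (t : 'I_l -> F) x :
  alpha t x (enum 'I_l) = ypol t (x - 1) / ypol t x.
Proof.
rewrite /alpha /ypol big_enum /= -prodf_div; apply: eq_bigr => i _.
by rewrite addrAC.
Qed.

Theorem theorem6p4 (F : fieldType) (charF0 : [pchar F] =i pred0)
    (k l : nat) (l1 l2 b : 'I_k -> F)
    (nondeg : forall s : 'I_k, l1 s + l2 s != 0)
    (q1 q2 : F) (q1nz : q1 != 0) (q2nz : q2 != 0)
    (t : 'I_l -> F)
    (hBAE : BAE l1 l2 b q1 q2 t)
    (hdist : injective t) :
  exists Q : 'cV[{mpoly F[l]}]_#|tbasis k|,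
    bethe_num l l1 l2 b = (@bethe_den F l) *: Q /\
    forall (m : nat) (x : F),
      (forall (j : nat) (s : 'I_k), (j <= m)%N -> x - j%:R != b s) ->
      (forall j : nat, (j <= m)%N -> ypol t (x - j%:R) != 0) ->
      DQ l1 l2 b q1 q2 m x *m map_mx (meval t) Q
      = DQt l1 l2 b q1 q2 t m x *: map_mx (meval t) Q.
Proof.
have two_neq0 : 2%:R != 0 :> F.
  by apply/negP => two0; have := charF0 2%N; rewrite !inE two0.
pose I := enum 'I_l; have uI : uniq I by apply: enum_uniq.
(* The witness is the exact polynomial quotient on the increasing list of all indices. *)
exists (bethe_quot l1 l2 b two_neq0 I); split.
  by rewrite bethe_num_seq bethe_den_seq -bethe_quotE.
move=> m x _ y_neq0.
rewrite -/(bethe_at t two_neq0 l1 l2 b I).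
have t_on := BAE_root hBAE.
pose h x := (\prod_(s < k) (x - b s))^-1.
have hxt j i : (j <= m)%N -> x - j%:R != t i.
  move=> /y_neq0; rewrite /ypol prodf_seq_neq0 => /allP/(_ i (mem_index_enum _)).
  by rewrite subr_eq0.
(* Unwanted terms of d carry q2 and b carries q1, whence the ratio; the common denominator of the
   operators cancels. *)
pose kap u i (J : seq 'I_l) := q2 / q1 * psi l2 b (t i) * mu t u i J.
pose eps u (i : 'I_l) J := (q2 * psi l2 b u - q1 * phi l1 b u) * h u * alpha t u J.
have offA u J : uniq J -> (forall i, u != t i) -> _ :=
  fun uJ ut => bethe_at_A hdist two_neq0 l1 l2 b uJ (fun i _ => ut i).
have offD u J : uniq J -> (forall i, u != t i) -> _ :=
  fun uJ ut => bethe_at_D hdist two_neq0 l1 l2 b uJ (fun i _ => ut i).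
apply: (@berezinian_eigenvector _ _ _ _ _ _ _ _ _ _ _ I _
  (fun i J => bethe_at t two_neq0 l1 l2 b J)
  _ _ kap eps).
- by move=> y; rewrite !Tmx_Tn !scalerA mulmx_scale2 Tn_B_shift // scaler0.
- move=> y; rewrite !Tmx_Tn !scalerA !mulmx_scale2.
  by rewrite (exchange_shift (Tn_AB l1 l2 b)); congr (_ *: _); ring.
- move=> y; rewrite !Tmx_Tn !scalerA !mulmx_scale2.
  by rewrite (exchange_shift (Tn_DB l1 l2 b)); congr (_ *: _); ring.
- move=> y; rewrite !Tmx_Tn !scalerA !mulmx_scale2.
  have := Tn_CB_shift l1 l2 b (y + 1); rewrite addrK => ->.
  rewrite !scalerBr; congr (_ *: _ - _ *: _ - _ *: _); ring.
- move=> u hu; have ut i : u != t i.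
    case: hu => [->|[j jm ->]]; last exact: hxt.
    by have := @hxt 0%N i isT; rewrite subr0.
  rewrite !Tmx_Tn !scalerA mulmxBl -!scalemxAl (offA _ _ uI ut) (offD _ _ uI ut).
  rewrite !scalerDr !scalerA opprD addrACA -scalerBl !scale_sumdel -sumdel_sub.
  rewrite (@eq_sumdel _ _ _ (fun _ _ => 0)) ?sumdel0 ?addr0.
    by congr (_ *: _); rewrite alpha_ypol zeta1_phi zeta2_psi; ring.
  (* The unwanted coefficient is a multiple of q2 psi(t_i) - q1 phi(t_i), which the Bethe ansatz
     equation kills. *)
  move=> i J _; rewrite !scalerA -scalerBl; apply/eqP; rewrite scaler_eq0; apply/orP; left.
  rewrite (_ : _ - _ = (q2 * psi l2 b (t i) - q1 * phi l1 b (t i)) * (h u * mu t u i J)).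
    by rewrite t_on subrr mul0r.
  by rewrite /h; ring.
move=> j jm u; have ut i : u != t i by apply: hxt.
split=> [||i J pI].
- rewrite !Tmx_Tn !scalerA -!scalemxAl (offD _ _ uI ut) scalerDr scale_sumdel scalerA.
  congr (_ *: _ + _); first by rewrite alpha_ypol zeta2_psi; ring.
  apply: eq_sumdel => i J _; rewrite -scalemxAl !scalerA; congr (_ *: _).
  by rewrite /kap -/(h u); move: (h u) (mu _ _ _ _) => hu mui; field.
- rewrite !Tmx_Tn !scalerA -!scalemxAl -scalemxAr bethe_at_C_mod // !scalerA.
  rewrite -[RHS]sub0r -[X in _ = X - _](sumdel0 _ I) -sumdel_sub scale_sumdel.
  apply: eq_sumdel => i J _; rewrite -scalemxAl sub0r -scaleNr !scalerA; congr (_ *: _).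
  rewrite /kap /eps -/(h u) -/(h (u + 1)).
  rewrite (_ : q1 * h (u + 1) * (q2 * h u) * _ =
    h (u + 1) * h u * q2 * mu t u i J * alpha t u J *
    (q1 * phi l1 b u * psi l2 b (t i) - q1 * phi l1 b (t i) * psi l2 b u)); last by ring.
  (* Replacing q1 phi(t_i) by q2 psi(t_i) brings out q1 phi(u) - q2 psi(u), the opposite of the
     factor in [eps]. *)
  rewrite t_on; move: (h u) (h (u + 1)) (mu _ _ _ _) => hu hu1 mui; field.
  exact: q1nz.
(* The smaller vectors are off shell, yet modulo the kernel of b(u + 1) both a and d act on them by
   scalars. *)
have uJ : uniq J by have := uI; rewrite -(perm_uniq pI) => /andP[].
rewrite !Tmx_Tn !scalerA -!scalemxAl mulmxBl -!scalemxAl mulmxBr -!scalemxAr.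
rewrite (bethe_at_exchange_mod (offA _ _ uJ ut)) (bethe_at_exchange_mod (offD _ _ uJ ut)).
rewrite !scalerA -scalerBl scalerA; congr (_ *: _).
by rewrite /eps -/(h u) -/(h (u + 1)); ring.
Qed.
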